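(* Let $\Omega\subset\mathbb{R}^n$ be a bounded domain satisfying the uniform exterior cone condition and let $p\in[2,\infty)$. Suppose that $\rho\in C(\overline\Omega)$ is a continuous admissible radius function in $\Omega$ satisfying $$\lambda\,\mathrm{dist}(x,\partial\Omega)\le\rho(x)\le\Lambda\,\mathrm{dist}(x,\partial\Omega)$$ for all $x\in\Omega$, where $$0<\lambda\le\Lambda<\frac{n+2}{n+p}.$$ Then for any $f\in C(\partial\Omega)$ there exists a unique solution $u_\rho\in C(\overline\Omega)$ to the Dirichlet problem $$\mathcal{T}_{\rho,p}u_\rho=u_\rho\ \text{ in }\Omega,\qquad u_\rho=f\ \text{ on }\partial\Omega.$$ Furthermore, for any norm-preserving continuous extension $u\in C(\overline\Omega)$ of $f$, the sequence of iterates $\{\mathcal{T}_{\rho,p}^k u\}_k$ converges uniformly to $u_\rho$ in $\overline\Omega$.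
   Context: Uniform exterior cone condition: for $\alpha\in(0,\frac{\pi}{2})$ and $r>0$ let $K_{\alpha,r}=\{x\in\mathbb{R}^n: x_1\le-|x|\cos\alpha\text{ and }|x|\le r\}$. A domain $\Omega\subset\mathbb{R}^n$ satisfies the uniform exterior cone condition if there exist constants $\alpha\in(0,\frac{\pi}{2})$ and $r>0$ such that for every $\xi\in\partial\Omega$ there is a rotation $R\in SO(n)$ with $\xi+R(K_{\alpha,r})\subset\mathbb{R}^n\setminus\Omega$. Admissible radius function: a function $\rho:\overline\Omega\to[0,\infty)$ with $0<\rho(x)\le\mathrm{dist}(x,\partial\Omega)$ for every $x\in\Omega$, and $\rho(x)=0$ if and only if $x\in\partial\Omega$. Write $B_\rho(x)=B(x,\rho(x))$ for the ball of center $x$ and radius $\rho(x)$. Operators: for $u\in C(\overline\Omega)$ put, for $x\in\Omega$, $\mathcal{S}_\rho u(x)=\frac12\sup_{B_\rho(x)}u+\frac12\inf_{B_\rho(x)}u$ and $\mathcal{M}_\rho u(x)=\frac{1}{|B_\rho(x)|}\int_{B_\rho(x)}u(y)\,dy$, and for $x\in\partial\Omega$, $\mathcal{S}_\rho u(x)=\mathcal{M}_\rho u(x)=u(x)$. For $p\in[2,\infty)$, $$\mathcal{T}_{\rho,p}=\frac{p-2}{n+p}\,\mathcal{S}_\rho+\frac{n+2}{n+p}\,\mathcal{M}_\rho .$$ $\mathcal{T}_{\rho,p}^k$ denotes the $k$-th iterate. (For $\rho$ continuous, $\mathcal{T}_{\rho,p}$ maps $C(\overline\Omega)$ into $C(\overline\Omega)$.)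 A norm-preserving continuous extension of $f\in C(\partial\Omega)$ is a function $u\in C(\overline\Omega)$ with $u|_{\partial\Omega}=f$ and $\|u\|_{\infty,\Omega}=\|f\|_{\infty,\partial\Omega}$. *)

(* Defs.v *)
From HB Require Import structures.
From mathcomp Require Import all_boot all_order all_algebra.
From mathcomp Require Import all_classical all_reals all_analysis.

Set Implicit Arguments.
Unset Strict Implicit.
Unset Printing Implicit Defensive.

Import Order.TTheory GRing.Theory Num.Theory.
Import numFieldNormedType.Exports.

Local Open Scope classical_set_scope.
Local Open Scope ring_scope.

(** R^n is ['rV[R]_n], with the product topology of the library.  The norm that
    the library puts on ['rV[R]_n] is the sup norm, hence [enorm] below.
    Elements of C(A) are represented by total functions [u : 'rV[R]_n -> R]
    with [{within A, continuous u}]; their values off [A] are irrelevant. *)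

Section Euclidean.
Context {R : realType} {n : nat}.
Implicit Types (x y : 'rV[R]_n) (A : set 'rV[R]_n).

Definition enorm x : R := Num.sqrt (\sum_(i < n) x 0 i ^+ 2).

Definition eball x (r : R) : set 'rV[R]_n := [set y | enorm (y - x) < r].

Definition boundary A : set 'rV[R]_n := closure A `\` A°.

Definition dist_set x A : R := inf [set enorm (x - y) | y in A].

Definition is_domain A := [/\ A !=set0, open A & connected A].

Definition supnorm A (u : 'rV[R]_n -> R) : R := sup [set `|u x| | x in A].

(** Acting on row vectors by [x |-> x *m Q]. *)
Definition special_orthogonal (Q : 'M[R]_n) := Q *m Q^T = 1%:M /\ \det Q = 1.

End Euclidean.

(** Lebesgue measure on R^n, on the product sigma-algebra (generated by the
    coordinates): the iterated product of the Lebesgue measure of R,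
    transported along (x, t) |-> (t, x_1, ..., x_n). *)

Fact measure_rV_display : measure_display. Proof. exact: default_measure_display. Qed.

Section measurable_rV.
Context {R : realType} (n : nat).

Definition rV_coord (i : 'I_n) (x : 'rV[R]_n) : measurableTypeR R := x 0 i.

Let rV_set0 : g_sigma_preimage rV_coord set0.
Proof. exact: sigma_algebra0. Qed.

Let rV_setC A : g_sigma_preimage rV_coord A -> g_sigma_preimage rV_coord (~` A).
Proof. exact: sigma_algebraC. Qed.

Let rV_bigcup (F : (set _)^nat) : (forall i, g_sigma_preimage rV_coord (F i)) ->
  g_sigma_preimage rV_coord (\bigcup_i (F i)).
Proof. exact: sigma_algebra_bigcup. Qed.

HB.instance Definition _ := @isMeasurable.Build measure_rV_display
  'rV[R]_n (g_sigma_preimage rV_coord) rV_set0 rV_setC rV_bigcup.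

End measurable_rV.

Section lebesgue_measure_rV.
Context {R : realType}.

Definition rV_cons n (p : 'rV[R]_n * measurableTypeR R) : 'rV[R]_n.+1 :=
  \row_i (if unlift ord0 i is Some j then p.1 0 j else p.2).

Lemma measurable_rV_coord n (i : 'I_n) :
  measurable_fun [set: 'rV[R]_n] (rV_coord i).
Proof.
move=> _ Y mY; rewrite setTI; apply: sub_sigma_algebra => /=.
rewrite -bigcup_seq/=; exists i => /=; first by rewrite mem_index_enum.
by exists Y => //; rewrite setTI.
Qed.

Lemma measurable_rV_cons n : measurable_fun setT (@rV_cons n).
Proof.
pose G := \big[setU/set0]_(i < n.+1)
  preimage_set_system setT (@rV_coord R n.+1 i) measurable.
apply: (@measurability _ _ _ _ _ _ G) => //.
move=> _ [B + <-].
rewrite /G -bigcup_seq/= => -[i _] [A mA <-].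
rewrite !setTI.
case: (unliftP ord0 i) => [j ->|->].
  rewrite (_ : _ @^-1` _ = (rV_coord j \o fst) @^-1` A); last first.
    by apply/seteqP; split => p; rewrite /preimage/= /rV_coord mxE liftK.
  rewrite -[X in measurable X]setTI.
  apply: (measurableT_comp (measurable_rV_coord j) measurable_fst) => //.
rewrite (_ : _ @^-1` _ = snd @^-1` A); last first.
  by apply/seteqP; split => p; rewrite /preimage/= /rV_coord mxE unlift_none.
by rewrite -[X in measurable X]setTI; exact: measurable_snd.
Qed.

Section rV_cons_measure.
Variables (n : nat) (mu : {measure set 'rV[R]_n -> \bar R}).

Definition rV_cons_measure : set 'rV[R]_n.+1 -> \bar R :=
  pushforward (mu \x (@lebesgue_measure R))%E (@rV_cons n).

Let mrV_cons := @measurable_rV_cons n.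

Let rV_cons_measure0 : rV_cons_measure set0 = 0%E.
Proof. by rewrite /rV_cons_measure measure0. Qed.

Let rV_cons_measure_ge0 A : (0 <= rV_cons_measure A)%E.
Proof. by rewrite /rV_cons_measure measure_ge0. Qed.

Let rV_cons_measure_sigma_additive : semi_sigma_additive rV_cons_measure.
Proof.
by rewrite /rV_cons_measure; exact: measure_semi_sigma_additive.
Qed.

HB.instance Definition _ := isMeasure.Build _ _ _ rV_cons_measure
  rV_cons_measure0 rV_cons_measure_ge0 rV_cons_measure_sigma_additive.

End rV_cons_measure.

Fixpoint lebesgue_measure_rV (n : nat) : {measure set 'rV[R]_n -> \bar R} :=
  match n with
  | 0 => \d_(0 : 'rV[R]_0)
  | m.+1 => rV_cons_measure (lebesgue_measure_rV m)
  end.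

End lebesgue_measure_rV.

Section ExteriorCone.
Context {R : realType} {n : nat}.

(** The dimension is [n.+1] because the cone refers to the first coordinate. *)
Definition cone (alpha r : R) : set 'rV[R]_n.+1 :=
  [set x : 'rV[R]_n.+1 | x 0 ord0 <= - enorm x * cos alpha /\ enorm x <= r].

Definition uniform_exterior_cone (Omega : set 'rV[R]_n.+1) :=
  exists alpha r : R, [/\ 0 < alpha < pi / 2, 0 < r &
    forall xi, boundary Omega xi ->
      exists Q : 'M[R]_n.+1, special_orthogonal Q /\
        [set xi + x *m Q | x in cone alpha r] `<=` ~` Omega].

End ExteriorCone.

Section Operators.
Context {R : realType} {n : nat}.
Implicit Types (Omega : set 'rV[R]_n) (rho u : 'rV[R]_n -> R).

Definition admissible_radius Omega rho :=
  [/\ forall x, closure Omega x -> 0 <= rho x,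
      forall x, Omega x -> 0 < rho x <= dist_set x (boundary Omega) &
      forall x, closure Omega x -> (rho x = 0 <-> boundary Omega x)].

(** [midrange_op], [mean_op] and [pmean_op] are S_rho, M_rho and T_(rho,p).  They
    leave [u] unchanged off [Omega], in particular on its boundary; for
    admissible [rho] the balls involved lie in [Omega], so that the values on
    [closure Omega] only depend on [u] there. *)
Definition midrange_op Omega rho u : 'rV[R]_n -> R := fun x =>
  if x \in Omega then
    2^-1 * sup [set u y | y in eball x (rho x)] +
    2^-1 * inf [set u y | y in eball x (rho x)]
  else u x.

Definition mean_op Omega rho u : 'rV[R]_n -> R := fun x =>
  if x \in Omega then
    (fine (lebesgue_measure_rV n (eball x (rho x))))^-1 *
    \int[lebesgue_measure_rV n]_(y in eball x (rho x)) u y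
  else u x.

Definition pmean_op Omega rho (p : R) u : 'rV[R]_n -> R := fun x =>
  (p - 2) / (n%:R + p) * midrange_op Omega rho u x +
  (n%:R + 2) / (n%:R + p) * mean_op Omega rho u x.

Definition dirichlet_solution Omega rho (p : R) (f u : 'rV[R]_n -> R) :=
  [/\ {within closure Omega, continuous u},
      forall x, Omega x -> pmean_op Omega rho p u x = u x &
      forall x, boundary Omega x -> u x = f x].

Definition norm_preserving_extension Omega (f u : 'rV[R]_n -> R) :=
  [/\ {within closure Omega, continuous u},
      forall x, boundary Omega x -> u x = f x &
      supnorm Omega u = supnorm (boundary Omega) f].

End Operators.

(* Main.v *)
Require Import Defs.
From HB Require Import structures.
From mathcomp Require Import all_boot all_order all_algebra.
From mathcomp Require Import all_classical all_reals all_analysis.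
From mathcomp Require Import measurable_realfun.
From mathcomp Require Import ring lra.

Set Implicit Arguments.
Unset Strict Implicit.
Unset Printing Implicit Defensive.

Import Order.TTheory GRing.Theory Num.Theory.
Import numFieldNormedType.Exports.

Local Open Scope classical_set_scope.
Local Open Scope ring_scope.

(** Write [T] for the operator, [wS] and [wM] for the weights of its midrange and
    mean parts, so that [0 <= wS], [0 < wM] and [wS + wM = 1].  [T] is monotone
    and commutes with the addition of constants, but its iterates need not be
    monotone in the exponent, and equicontinuity of the iterates is delicate.
    The proof goes through half-relaxed limits instead, which need no regularity
    of the iterates that is uniform in the exponent.

    Let [u_k] be the iterates of an extension [u] of [f], let
    [U x = limsup u_k y] as [k] tends to infinity and [y] to [x], and let [V] be
    the corresponding liminf.  Then [V <= U], [U] is upper and [V] lower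
    semicontinuous.

    - [U] is a subsolution and [V] a supersolution ([ulim_subsolution]).  The mean
      passes to the limit by Fatou's lemma and the continuity of the volume of
      balls, the infimum directly.  The supremum passes to the limit by
      compactness, but with the closed ball in place of the open one
      ([pmean_limsup]).

    - [U <= f <= V] on the boundary ([ulim_boundary]).  The exterior cone yields,
      at each small scale [s] around a boundary point, a ball of radius
      [kappa * s] and centre [z] outside the domain.  For large [m] the function
      [y |-> |y - z|^(-2m)] is a subsolution: for the midrange by the
      arithmetic-geometric mean inequality ([pmean_le_rpow]), for the mean by a
      convexity estimate valid on every ball whose closure avoids [z] ([submean_rpow]).
      Used as a barrier, it shows that an excess [L] of all the iterates over
      [f] near the boundary point improves to [theta * L] in a smaller
      neighbourhood, where [theta < 1] depends on neither [L] nor the scale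
      ([barrier_step]).

    - Comparison ([comparison]): a subsolution below a supersolution on the
      boundary is below it everywhere.  At an interior maximum point of [U - V],
      the lower semicontinuity of [V] bounds its supremum over the closed ball by
      that over the open ball, so the mismatch of closed and open balls is
      harmless; as [0 < wM], the mean of [U - V] over the ball is at least its
      maximum, hence [U - V] is maximal on the ball.  A maximum point with
      largest first coordinate contradicts this.

    Hence [U = V].  This common value is continuous and a solution, the
    convergence is uniform by compactness ([iterates_converge]), and comparison
    also gives uniqueness.  Existence follows by starting from a Tietze extension
    of [f]. *)

(** * The Euclidean norm *)

Section Euclid.
Context {R : realType} {n : nat}.
Implicit Types (x y z : 'rV[R]_n) (A : set 'rV[R]_n).

Definition dot x y : R := \sum_(i < n) x 0 i * y 0 i.

Lemma dotC x y : dot x y = dot y x.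
Proof. by apply: eq_bigr => i _; rewrite mulrC. Qed.

Lemma dotDl x y z : dot (x + y) z = dot x z + dot y z.
Proof. by rewrite /dot -big_split/=; apply: eq_bigr => i _; rewrite mxE mulrDl. Qed.

Lemma dotDr x y z : dot z (x + y) = dot z x + dot z y.
Proof. by rewrite dotC dotDl !(dotC z). Qed.

Lemma dotZl a x y : dot (a *: x) y = a * dot x y.
Proof. by rewrite /dot big_distrr/=; apply: eq_bigr => i _; rewrite mxE mulrA. Qed.

Lemma dotZr a x y : dot y (a *: x) = a * dot y x.
Proof. by rewrite dotC dotZl dotC. Qed.

Lemma dotNl x y : dot (- x) y = - dot x y.
Proof. by rewrite -scaleN1r dotZl mulN1r. Qed.

Lemma dotNr x y : dot y (- x) = - dot y x.
Proof. by rewrite dotC dotNl dotC. Qed.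

Lemma dotDD x y : dot (x + y) (x + y) = dot x x + 2 * dot x y + dot y y.
Proof. by rewrite !(dotDl, dotDr) (dotC y x); ring. Qed.

Lemma dotxx_ge0 x : 0 <= dot x x.
Proof. by apply: sumr_ge0 => i _; rewrite -expr2 sqr_ge0. Qed.

Lemma sqr_enorm x : enorm x ^+ 2 = dot x x.
Proof.
rewrite /enorm sqr_sqrtr; last by apply: sumr_ge0 => i _; rewrite sqr_ge0.
by apply: eq_bigr => i _; rewrite expr2.
Qed.

Lemma enorm_ge0 x : 0 <= enorm x.
Proof. exact: sqrtr_ge0. Qed.

Lemma le_enorm x (c : R) : 0 <= c -> (enorm x <= c) = (dot x x <= c ^+ 2).
Proof. by move=> c0; rewrite -sqr_enorm ler_pXn2r// nnegrE enorm_ge0. Qed.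

Lemma ge_enorm x (c : R) : 0 <= c -> (c <= enorm x) = (c ^+ 2 <= dot x x).
Proof. by move=> c0; rewrite -sqr_enorm ler_pXn2r// nnegrE enorm_ge0. Qed.

Lemma enormZ a x : enorm (a *: x) = `|a| * enorm x.
Proof.
apply/eqP; rewrite -(@eqrXn2 _ 2)// ?mulr_ge0 ?enorm_ge0//.
by rewrite exprMn !sqr_enorm dotZl dotZr mulrA -expr2 real_normK// num_real.
Qed.

Lemma enormN x : enorm (- x) = enorm x.
Proof. by rewrite -scaleN1r enormZ normrN1 mul1r. Qed.

Lemma enormB x y : enorm (x - y) = enorm (y - x).
Proof. by rewrite -enormN opprB. Qed.

Lemma enorm0 : enorm (0 : 'rV[R]_n) = 0.
Proof. by rewrite -(scale0r 0) enormZ normr0 mul0r. Qed.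

Lemma coord_le_enorm x i : `|x 0 i| <= enorm x.
Proof.
rewrite ge_enorm// /dot (bigD1 i)//= real_normK ?num_real// expr2 lerDl.
by apply: sumr_ge0 => j _; rewrite -expr2 sqr_ge0.
Qed.

Lemma enorm_eq0 x : enorm x = 0 -> x = 0.
Proof.
move=> x0; apply/rowP => i; rewrite mxE; apply/eqP; rewrite -normr_le0.
by rewrite (le_trans (coord_le_enorm x i))// x0.
Qed.

Lemma dot_le_enorm x y : dot x y <= enorm x * enorm y.
Proof.
have [x0|x0] := eqVneq (enorm x) 0.
  by rewrite (enorm_eq0 x0) enorm0 mul0r -(scale0r 0) dotZl mul0r.
have [y0|y0] := eqVneq (enorm y) 0.
  by rewrite (enorm_eq0 y0) enorm0 mulr0 -(scale0r 0) dotZr mul0r.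
have xp : 0 < enorm x by rewrite lt_neqAle eq_sym x0 enorm_ge0.
have yp : 0 < enorm y by rewrite lt_neqAle eq_sym y0 enorm_ge0.
have := dotxx_ge0 (enorm y *: x - enorm x *: y).
rewrite !(dotDl, dotDr, dotNl, dotNr, dotZl, dotZr) (dotC y x).
rewrite -!sqr_enorm.
set a := enorm x; set b := enorm y; set d := dot x y => H.
have {}H : 0 <= (a * b) * (a * b - d) by lra.
by rewrite -subr_ge0 -(pmulr_rge0 _ (mulr_gt0 xp yp)).
Qed.

Lemma enormD x y : enorm (x + y) <= enorm x + enorm y.
Proof.
rewrite le_enorm ?addr_ge0 ?enorm_ge0//.
rewrite !(dotDl, dotDr) (dotC y x) -!sqr_enorm.
by have := dot_le_enorm x y; lra.
Qed.

Lemma enorm_tri x y z : enorm (x - z) <= enorm (x - y) + enorm (y - z).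
Proof. by rewrite (le_trans _ (enormD _ _))// addrA subrK. Qed.

Lemma enorm_le_coord x (s : R) : (forall i, `|x 0 i| <= s) ->
  enorm x <= n%:R * s.
Proof.
move=> xs; have [n0|n0] := posnP n.
  have -> : x = 0 by apply/rowP => i; have := ltn_ord i; rewrite {2}n0.
  by rewrite enorm0 n0 mul0r.
have s0 : 0 <= s by apply: le_trans (xs (Ordinal n0)).
rewrite le_enorm ?mulr_ge0//.
apply: (@le_trans _ _ (\sum_(i < n) s ^+ 2)).
  apply: ler_sum => i _; rewrite -expr2 -[leLHS]real_normK ?num_real//.
  by rewrite ler_pXn2r// nnegrE.
rewrite sumr_const card_ord exprMn -[leLHS]mulr_natl.
rewrite ler_wpM2r ?sqr_ge0//.
by rewrite -natrX ler_nat -[leqLHS]expn1 leq_pexp2l.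
Qed.

Lemma eball_center x (r : R) : 0 < r -> eball x r x.
Proof. by move=> r0; rewrite /eball/= subrr enorm0. Qed.

Lemma nbhs_eballP x A :
  nbhs x A <-> exists2 e : R, 0 < e & eball x e `<=` A.
Proof.
split.
  move=> /nbhs_ballP[e/= e0 xeA]; exists e => // y xy; apply: xeA.
  split=> // i j; rewrite ord1 {i} /ball/=.
  rewrite (le_lt_trans _ xy)// -opprB normrN.
  by have := coord_le_enorm (y - x) j; rewrite !mxE.
move=> [e e0 xeA]; apply/nbhs_ballP.
pose d := e / (n.+1)%:R.
have d0 : 0 < d by rewrite divr_gt0.
exists d => //= y xy; apply: xeA.
rewrite /eball/= (@le_lt_trans _ _ (n%:R * d))//.
  apply: enorm_le_coord => i; have := xy.2 0 i.
  by rewrite /ball/= !mxE distrC => /ltW.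
by rewrite /d mulrCA gtr_pMr// ltr_pdivrMr// mul1r ltr_nat.
Qed.

Lemma nbhs_eball x (e : R) : 0 < e -> nbhs x (eball x e).
Proof. by move=> e0; apply/nbhs_eballP; exists e. Qed.

Lemma open_eball x (r : R) : open (eball x r).
Proof.
rewrite openE => y xy; apply/nbhs_eballP.
exists (r - enorm (y - x)); first by rewrite subr_gt0.
move=> z yz; rewrite /eball/= (le_lt_trans (enorm_tri z y x))//.
by rewrite -ltrBrDr.
Qed.

Lemma within_continuous_eballP A (u : 'rV[R]_n -> R) :
  {within A, continuous u} <->
  forall x, A x -> forall e : R, 0 < e -> exists2 d : R, 0 < d &
    forall y, A y -> enorm (y - x) < d -> `|u y - u x| < e.
Proof.
rewrite subspace_continuousP; split => uC x Ax.
  move=> e e0; have /cvgrPdist_lt/(_ _ e0) := uC x Ax.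
  rewrite near_withinE => /nbhs_eballP[d d0 xd]; exists d => // y Ay yx.
  by rewrite distrC; exact: xd.
apply/cvgrPdist_lt => e e0; have [d d0 xd] := uC x Ax e e0.
rewrite near_withinE; apply/nbhs_eballP; exists d => // y yx Ay.
by rewrite distrC; exact: xd.
Qed.

End Euclid.
(** * Lebesgue measure of cubes, spheres and reflected sets *)

Section MeasureRV.
Context {R : realType}.
Local Notation mu n := (@lebesgue_measure_rV R n).

Definition cube n (c : 'rV[R]_n) (s : R) : set 'rV[R]_n :=
  [set y | forall i, `|y 0 i - c 0 i| < s].

Lemma measurable_cube n (c : 'rV[R]_n) s : measurable (cube c s).
Proof.
rewrite (_ : cube c s = \bigcap_(i in [set: 'I_n])
    (rV_coord i @^-1` [set t : R | `|t - c 0 i| < s])); last first.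
  apply/seteqP; split => y /= yc; first by move=> i _; exact: yc.
  by move=> i; exact: (yc i).
apply: fin_bigcap_measurable; first exact: finite_finset.
move=> i _; rewrite -[X in measurable X]setTI.
apply: measurable_rV_coord => //.
rewrite (_ : [set t | _] = ball (c 0 i) s); first exact: measurable_ball.
by apply/seteqP; split => t; rewrite /ball/= distrC.
Qed.

Lemma cube_eball n (c : 'rV[R]_n) (s : R) : eball c s `<=` cube c s.
Proof.
move=> y ycs i; rewrite (le_lt_trans _ ycs)//.
by have := coord_le_enorm (y - c) i; rewrite !mxE.
Qed.

Lemma eball_cube n (c : 'rV[R]_n) (s r : R) : n%:R * s < r ->
  cube c s `<=` eball c r.
Proof.
move=> sr y yc; rewrite /eball/= (le_lt_trans _ sr)//.
by apply: enorm_le_coord => i; rewrite !mxE ltW.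
Qed.

(** The measurable sets are generated by the coordinates; an open set is the
    countable union of the cubes with rational centres that it contains. *)
Lemma open_measurable_rV n (A : set 'rV[R]_n) : open A -> measurable A.
Proof.
move=> oA.
pose c (q : 'rV[rat]_n * nat) : set 'rV[R]_n :=
  cube (\row_i ratr (q.1 0 i)) (q.2.+1%:R^-1).
rewrite (_ : A = \bigcup_q (if `[< c q `<=` A >] then c q else set0)).
  apply: countable_bigcupT_measurable => [|q]; first exact: countableP.
  by case: ifP => // _; exact: measurable_cube.
apply/seteqP; split => [y Ay|y [q _]]; last first.
  by case: asboolP => // cqA cq; exact: cqA.
have /nbhs_eballP[e e0 yeA] : nbhs y A by exact: open_nbhs_nbhs.
have [k ke] : exists k : nat, n%:R * (2 * k.+1%:R^-1) < e.
  have [k] := ltr_add_invr (divr_gt0 e0 (ltr0Sn R (2 * n))).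
  rewrite add0r => ke; exists k.
  rewrite (@lt_le_trans _ _ ((2 * n).+1%:R * (e / (2 * n).+1%:R)))//; last first.
    by rewrite mulrCA divff ?mulr1// pnatr_eq0.
  rewrite mulrA -natrM mulnC (@le_lt_trans _ _ ((2 * n).+1%:R * k.+1%:R^-1))//.
    by rewrite ler_wpM2r// ler_nat.
  by rewrite ltr_pM2l// ltr0n.
have H i : {q : rat | `|y 0 i - ratr q| < k.+1%:R^-1}.
  apply: cid; have k0 : 0 < k.+1%:R^-1 :> R by rewrite invr_gt0.
  have yk : y 0 i - k.+1%:R^-1 < y 0 i + k.+1%:R^-1.
    by rewrite ltrD2l gtrN.
  have [q] := rat_in_itvoo yk.
  rewrite in_itv/= => /andP[q1 q2]; exists q.
  by rewrite ltr_distlC q1.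
exists (\row_i sval (H i), k) => //.
have cy : c (\row_i sval (H i), k) y.
  by move=> i; rewrite /c/= !mxE; exact: (svalP (H i)).
rewrite asboolT// => z cz; apply: yeA; apply: (eball_cube (s := 2 * k.+1%:R^-1)) => //.
move=> i; have := cy i; have := cz i; rewrite /c/= !mxE => zi yi.
rewrite (le_lt_trans (ler_distD (ratr (sval (H i))) _ _))//.
by rewrite mulrDl mul1r ltrD// distrC.
Qed.

Lemma measurable_eball n (x : 'rV[R]_n) r : measurable (eball x r).
Proof. by apply: open_measurable_rV; exact: open_eball. Qed.

Lemma mu_S n (A : set 'rV[R]_n.+1) : mu n.+1 A =
  (\int[mu n]_x (@lebesgue_measure R
     [set t : measurableTypeR R | A (rV_cons (x, t))]))%E.
Proof.
rewrite /= /rV_cons_measure /pushforward /product_measure1/=.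
apply: eq_integral => x _ /=; congr (lebesgue_measure _).
by apply/seteqP; split => t; rewrite /xsection/= inE.
Qed.

Lemma mu_cube n (c : 'rV[R]_n) s : 0 < s -> mu n (cube c s) = ((2 * s) ^+ n)%:E.
Proof.
move=> s0; elim: n c => [c|n IH c].
  rewrite /= (_ : cube c s = setT) ?diracT ?expr0//.
  by apply/seteqP; split => // y _ [].
pose c' : 'rV[R]_n := \row_j c 0 (lift ord0 j).
rewrite mu_S (eq_integral (fun x => (2 * s)%:E * (\1_(cube c' s) x)%:E)%E).
  rewrite ge0_integralZl//=; last 2 first.
  - by apply/measurable_EFinP; apply: measurable_indic; exact: measurable_cube.
  - by rewrite lee_fin mulr_ge0// ltW.
  rewrite integral_indic//; last exact: measurable_cube.
  by rewrite setIT IH -EFinM exprS.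
move=> x _; rewrite indicE; have [xc|xc] := boolP (x \in cube c' s).
  rewrite mule1 (_ : [set t | _] = `](c 0 ord0 - s), (c 0 ord0 + s)[%classic).
    rewrite lebesgue_measure_itv/= lte_fin -EFinB.
    rewrite ifT; first by congr (_ %:E); lra.
    by lra.
  apply/seteqP; split => t /=; rewrite in_itv/=.
    by move=> /(_ ord0); rewrite !mxE unlift_none/= ltr_norml => /andP[? ?]; lra.
  move=> /andP[t1 t2] i; rewrite !mxE; case: (unliftP ord0 i) => [j ->|->] /=.
    by move: xc; rewrite inE => /(_ j); rewrite !mxE.
  by rewrite ltr_norml; lra.
rewrite mule0 (_ : [set t | _] = set0) ?measure0//.
apply/seteqP; split => t //= H; move/negP: xc; apply; rewrite inE => j.
by have := H (lift ord0 j); rewrite !mxE liftK.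
Qed.

Lemma dot_rV_cons n (x : 'rV[R]_n) (t : R) (c : 'rV[R]_n.+1) :
  dot (rV_cons (x, t) - c) (rV_cons (x, t) - c) =
  (t - c 0 ord0) ^+ 2 + dot (x - \row_j c 0 (lift ord0 j))
     (x - \row_j c 0 (lift ord0 j)).
Proof.
rewrite /dot big_ord_recl !mxE unlift_none/= expr2; congr (_ + _).
by apply: eq_bigr => i _; rewrite !mxE liftK.
Qed.

(** The sections of a sphere along the first coordinate have at most two points. *)
Lemma mu_sphere n (c : 'rV[R]_n.+1) r : mu n.+1 [set y | enorm (y - c) = r] = 0%E.
Proof.
rewrite mu_S integral0_eq// => x _.
apply: countable_lebesgue_measure0; apply: finite_set_countable.
pose w := Num.sqrt (r ^+ 2 - dot (x - \row_j c 0 (lift ord0 j))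
     (x - \row_j c 0 (lift ord0 j))).
apply: (@sub_finite_set _ _ [set c 0 ord0 + w; c 0 ord0 - w]).
  move=> t /= tr.
  have : `|t - c 0 ord0| = w.
    by rewrite -sqrtr_sqr /w -tr sqr_enorm dot_rV_cons addrK.
  case: (ler0P (t - c 0 ord0)) => _ tw; [right|left]; lra.
exact: finite_set2.
Qed.

Lemma measurable_refl n (c : 'rV[R]_n) :
  measurable_fun setT (fun y : 'rV[R]_n => c - y).
Proof.
pose G := \big[setU/set0]_(i < n)
  preimage_set_system setT (@rV_coord R n i) measurable.
apply: (@measurability _ _ _ _ _ _ G) => //.
move=> _ [B + <-].
rewrite /G -bigcup_seq/= => -[i _] [A mA <-].
rewrite !setTI (_ : _ @^-1` _ = (fun y => c 0 i - rV_coord i y) @^-1` A).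
  rewrite -[X in measurable X]setTI.
  apply: (measurable_funB (measurable_cst _) (measurable_rV_coord i)) => //.
by apply/seteqP; split => y; rewrite /rV_coord/= !mxE.
Qed.

Lemma lebesgue_measure_refl (c : R) (A : set R) : measurable A ->
  lebesgue_measure [set t | A (c - t)] = lebesgue_measure A.
Proof.
move=> mA.
have mf : measurable_fun [set: measurableTypeR R]
   (fun t : measurableTypeR R => c - t : measurableTypeR R).
  by apply: measurable_funB.
apply/esym; rewrite -[RHS]/(pushforward lebesgue_measure
  (fun t : measurableTypeR R => c - t : measurableTypeR R) A).
apply: lebesgue_measure_unique => //= _ [[a b]] _ <-.
rewrite /pushforward/=.
rewrite (_ : _ @^-1` _ = `[(c - b), (c - a)[%classic).
  rewrite !lebesgue_measure_itv/= !lte_fin -!EFinB.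
  by rewrite ltrD2l ltrN2; case: ifP => // _; congr (_ %:E); lra.
by apply/seteqP; split => t /=; rewrite !in_itv/= => /andP[? ?]; lra.
Qed.

(** By Fubini, from the invariance of the one-dimensional measure; used to show
    that odd functions on balls average to zero. *)
Lemma mu_refl n (c : 'rV[R]_n) (A : set 'rV[R]_n) : measurable A ->
  mu n [set y | A (c - y)] = mu n A.
Proof.
elim: n c A => [c A mA|n IH c A mA].
  rewrite /= /dirac !indicE; suff -> : (0 \in [set y | A (c - y)]) = (0 \in A) by [].
  by apply/idP/idP; rewrite !inE/= (_ : c - 0 = 0)//; apply/rowP => -[].
pose c' : 'rV[R]_n := \row_j c 0 (lift ord0 j).
pose phi (x : 'rV[R]_n) := (lebesgue_measure
     [set t : measurableTypeR R | A (rV_cons (x, t))]).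
have mA' : measurable (@rV_cons R n @^-1` A).
  by rewrite -[X in measurable X]setTI; exact: measurable_rV_cons.
have mphi : measurable_fun setT phi.
  rewrite (_ : phi = lebesgue_measure \o xsection (@rV_cons R n @^-1` A)).
    exact: measurable_fun_xsection.
  apply/funext => x /=; congr (lebesgue_measure _).
  by apply/seteqP; split => t; rewrite /xsection/= inE.
rewrite !mu_S -/phi.
transitivity (\int[mu n]_x phi (c' - x)%R)%E.
  apply: eq_integral => x _; rewrite /phi -(lebesgue_measure_refl (c 0 ord0)).
    congr (lebesgue_measure _); apply/funext => t /=; congr A.
    by apply/rowP => i; rewrite !mxE; case: unliftP => [j ->|->] /=;
      rewrite ?mxE// subKr.
  pose g (t : measurableTypeR R) := c - @rV_cons R n (x, t).
  have mg : measurable_fun setT g.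
    apply: (measurableT_comp (measurable_refl c)).
    by apply: (measurableT_comp (@measurable_rV_cons R n)); exact: measurable_pair1.
  by rewrite -[X in measurable X]setTI; exact: mg.
have := @ge0_integral_pushforward _ _ _ _ R _ (measurable_refl c') (mu n) setT phi
  measurableT mphi (fun _ _ => measure_ge0 _ _).
rewrite preimage_setT => <-.
apply: eq_measure_integral => [|mr B mB _]; first exact: measurable_refl.
exact: IH.
Qed.
End MeasureRV.
(** * Volumes of balls and means over balls *)

Section EinfLimits.
Context {R : realType}.
Local Open Scope ereal_scope.
Implicit Types (u : (\bar R)^nat) (l : \bar R).

Lemma ge_limn_einf u l : (\forall j \near \oo, l <= u j) -> l <= limn_einf u.
Proof.
move=> [N _ Nl]; rewrite limn_einf_lim.
apply: (@le_trans _ _ (einfs u N)).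
  by apply: le_ereal_inf_tmp => _ [m /= Nm <-]; exact: Nl.
rewrite (cvg_lim _ (ereal_nondecreasing_cvgn (nondecreasing_einfs u)))//.
by apply: ereal_sup_ubound; exists N.
Qed.

Lemma lt_limn_einf u l : l < limn_einf u -> \forall j \near \oo, l < u j.
Proof.
rewrite limn_einf_lim.
have /cvg_lim -> // := @ereal_nondecreasing_cvgn _ _ (nondecreasing_einfs u).
move=> /ereal_sup_gt[_ [N _ <-] lN]; exists N => // j /= Nj.
by apply: (lt_le_trans lN); apply: ereal_inf_lbound; exists j.
Qed.

End EinfLimits.

Section Balls.
Context {R : realType} {n : nat}.
Local Notation mu := (@lebesgue_measure_rV R n).
Implicit Types (x y z : 'rV[R]_n) (r : R) (g h : 'rV[R]_n -> R) (A : set 'rV[R]_n).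

Lemma mu_eball_lty x r : (mu (eball x r) < +oo)%E.
Proof.
have : (mu (eball x r) <= mu (cube x (`|r| + 1)))%E.
  apply: le_measure; rewrite ?inE; [exact: measurable_eball|exact: measurable_cube|].
  move=> y xy; apply: cube_eball; rewrite /eball/= (lt_le_trans xy)//.
  by rewrite (le_trans (ler_norm r))// lerDl.
by move=> /le_lt_trans; apply; rewrite mu_cube ?ltry// ltr_wpDl.
Qed.

Definition vol x r : R := fine (mu (eball x r)).

Lemma volE x r : mu (eball x r) = (vol x r)%:E.
Proof. by rewrite fineK// ge0_fin_numE// mu_eball_lty. Qed.

Lemma vol_le x r : 0 < r -> vol x r <= (2 * r) ^+ n.
Proof.
move=> r0; rewrite -lee_fin -volE -(mu_cube x r0).
apply: le_measure; rewrite ?inE; [exact: measurable_eball|exact: measurable_cube|].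
exact: cube_eball.
Qed.

Lemma vol_ge x r : 0 < r -> (r / n.+1%:R) ^+ n <= vol x r.
Proof.
move=> r0; have s0 : 0 < r / n.+1%:R / 2 by rewrite !divr_gt0.
rewrite -lee_fin -volE (_ : r / _ = 2 * (r / n.+1%:R / 2)); last by field.
rewrite -(mu_cube x s0).
apply: le_measure; rewrite ?inE; [exact: measurable_cube|exact: measurable_eball|].
apply: eball_cube.
rewrite (_ : _ * _ = r * (n%:R / n.+1%:R / 2)); last by field.
rewrite gtr_pMr// ltr_pdivrMr// mul1r (@le_lt_trans _ _ 1) ?ltr1n//.
by rewrite ler_pdivrMr// mul1r ler_nat.
Qed.

Lemma vol_gt0 x r : 0 < r -> 0 < vol x r.
Proof. by move=> r0; rewrite (lt_le_trans _ (vol_ge x r0))// exprn_gt0// divr_gt0. Qed.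

(** Comparison with cubes gives a constant depending only on the dimension, which
    is all that the estimate of [submean_rpow] requires. *)
Lemma vol_doubling : exists2 k : R, 0 < k &
  forall x y r, 0 < r -> k * vol x r <= vol y (r / 8).
Proof.
exists ((16 * n.+1%:R)^-1 ^+ n); first by rewrite exprn_gt0// invr_gt0 mulr_gt0.
move=> x y r r0; have r80 : 0 < r / 8 by rewrite divr_gt0.
rewrite (le_trans _ (vol_ge y r80))//.
have k0 : 0 <= (16 * n.+1%:R)^-1 ^+ n :> R.
  by rewrite exprn_ge0// invr_ge0 mulr_ge0.
apply: (le_trans (ler_wpM2l k0 (vol_le x r0))).
rewrite -exprMn le_eqVlt; apply/orP; left; apply/eqP; congr (_ ^+ _).
by field.
Qed.

(** Semicontinuity is taken relative to [A], since functions on the closure of the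
    domain have arbitrary values elsewhere. *)
Definition usc_on A g := forall x, A x -> forall e : R, 0 < e ->
  exists2 d : R, 0 < d & forall y, A y -> enorm (y - x) < d -> g y < g x + e.

Lemma usc_onS A B g : A `<=` B -> usc_on B g -> usc_on A g.
Proof.
move=> AB uB x /AB Bx e e0; have [d d0 H] := uB x Bx e e0.
by exists d => // y /AB By; exact: H.
Qed.

Lemma continuous_usc_on A g : {within A, continuous g} <->
  usc_on A g /\ usc_on A (\- g).
Proof.
split=> [/within_continuous_eballP gC|[gu gl]].
  split=> x Ax e e0; have [d d0 H] := gC x Ax e e0; exists d => // y Ay yx;
    have := H y Ay yx; rewrite ltr_norml => /andP[? ?] /=; lra.
apply/within_continuous_eballP => x Ax e e0.
have [d d0 H] := gu x Ax e e0; have [d' d0' H'] := gl x Ax e e0.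
exists (Num.min d d'); first by rewrite lt_min d0.
move=> y Ay; rewrite lt_min => /andP[/(H y Ay) yx /(H' y Ay)/= yx'].
by rewrite ltr_norml; apply/andP; split; lra.
Qed.

Lemma usc_on_measurable A g : open A -> usc_on A g -> measurable_fun A g.
Proof.
move=> oA gu mA; apply: (measurability _ (RGenInftyO.measurableE R)) => //.
move=> _ [_ [a ->] <-]; apply: open_measurable_rV; rewrite openE => x [Ax /=].
rewrite in_itv/= => gxa.
have e0 : 0 < a - g x by rewrite subr_gt0.
have [d d0 H] := gu x Ax _ e0.
have /nbhs_eballP[d' d0' xA] : nbhs x A by exact: open_nbhs_nbhs.
apply/nbhs_eballP; exists (Num.min d d'); first by rewrite lt_min d0.
move=> y; rewrite /eball/= lt_min => /andP[yx /xA Ay]; split => //=.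
by rewrite in_itv/=; have := H y Ay yx; rewrite addrC subrK.
Qed.

Definition tame A g :=
  measurable_fun A g /\ exists C : R, forall y, A y -> `|g y| <= C.

Lemma tame_integrable x r g : tame (eball x r) g ->
  mu.-integrable (eball x r) (EFin \o g).
Proof.
move=> [mg [C gC]]; apply: measurable_bounded_integrable => //.
- exact: measurable_eball.
- exact: mu_eball_lty.
exists C; split; first exact: num_real.
by move=> M CM y /gC /le_trans; apply; exact: ltW.
Qed.

Lemma tame_cst A (c : R) : tame A (fun=> c).
Proof. by split; [exact: measurable_cst|exists `|c|]. Qed.

Lemma tameN A g : tame A g -> tame A (\- g).
Proof.
move=> [mg [C gC]]; split; first exact: measurable_funN.
by exists C => y /gC; rewrite normrN.
Qed.

Lemma tameD A g h : tame A g -> tame A h -> tame A (g \+ h).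
Proof.
move=> [mg [C gC]] [mh [D hD]]; split; first exact: measurable_funD.
by exists (C + D) => y Ay; rewrite (le_trans (ler_normD _ _))// lerD// ?gC ?hD.
Qed.

Lemma tameZ A (c : R) g : tame A g -> tame A (fun y => c * g y).
Proof.
move=> [mg [C gC]]; split; first exact: measurable_funM.
by exists (`|c| * C) => y Ay; rewrite normrM ler_wpM2l// gC.
Qed.

Definition avg x r g : R := (vol x r)^-1 * \int[mu]_(y in eball x r) g y.

Lemma avg_cst x r c : 0 < r -> avg x r (fun=> c) = c.
Proof.
move=> r0; rewrite /avg Rintegral_cst//; last exact: measurable_eball.
by rewrite mulrCA mulVf ?mulr1// gt_eqF// vol_gt0.
Qed.

Lemma avgD x r g h : tame (eball x r) g -> tame (eball x r) h ->
  avg x r (g \+ h) = avg x r g + avg x r h.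
Proof.
move=> tg th; rewrite /avg RintegralD ?mulrDr//; last 2 first.
- exact: tame_integrable.
- exact: tame_integrable.
exact: measurable_eball.
Qed.

Lemma avgZ x r c g : tame (eball x r) g ->
  avg x r (fun y => c * g y) = c * avg x r g.
Proof.
move=> tg; rewrite /avg RintegralZl 1?mulrCA//; first exact: measurable_eball.
exact: tame_integrable.
Qed.

Lemma avgN x r g : tame (eball x r) g -> avg x r (\- g) = - avg x r g.
Proof.
move=> tg; rewrite -mulN1r -avgZ//; congr avg.
by apply/funext => y /=; rewrite mulN1r.
Qed.

Lemma le_avg x r g h : 0 < r -> tame (eball x r) g -> tame (eball x r) h ->
  (forall y, eball x r y -> g y <= h y) -> avg x r g <= avg x r h.
Proof.
move=> r0 tg th gh; rewrite /avg ler_wpM2l//.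
  by rewrite invr_ge0 ltW// vol_gt0.
apply: le_Rintegral => //; [exact: measurable_eball|exact: tame_integrable..].
Qed.

Lemma measurable_dot v x : measurable_fun setT (fun y => dot v (y - x)).
Proof.
have cg : {within setT, continuous (fun y => dot v (y - x))}.
  apply/within_continuous_eballP => y _ e e0.
  exists (e / (enorm v + 1)); first by rewrite divr_gt0// ltr_wpDl// enorm_ge0.
  move=> z _ zy; rewrite -dotNr -dotDr opprB addrA subrK.
  have H w : dot v w <= enorm v * enorm w := dot_le_enorm v w.
  have v1 : enorm v * enorm (z - y) < e.
    rewrite ltr_pdivlMr ?ltr_wpDl ?enorm_ge0// in zy.
    by apply: le_lt_trans zy; rewrite mulrC ler_wpM2l ?enorm_ge0// lerDl.
  rewrite ltr_norml (le_lt_trans (H _) v1) andbT ltrNl -dotNr.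
  by rewrite (le_lt_trans (H _))// enormN.
apply: usc_on_measurable; first exact: openT.
by have /continuous_usc_on[] := cg.
Qed.

Lemma tame_dot x r v : tame (eball x r) (fun y => dot v (y - x)).
Proof.
split; first by apply: measurable_funTS; exact: measurable_dot.
exists (enorm v * r) => y /ltW xy.
rewrite ler_norml lerNl -dotNr.
have H w : enorm w <= r -> dot v w <= enorm v * r.
  by move=> wr; rewrite (le_trans (dot_le_enorm v w))// ler_wpM2l// enorm_ge0.
by rewrite !H// enormN.
Qed.

(** The first moment vanishes, by symmetry of the ball about its centre. *)
Lemma avg_odd x r v : avg x r (fun y => dot v (y - x)) = 0.
Proof.
rewrite /avg; set g := (fun y => dot v (y - x)); set I := Rintegral _ _ _.
suff I0 : I = 0 by rewrite I0 mulr0.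
have mg : measurable_fun setT g := measurable_dot v x.
have tg : tame (eball x r) g := tame_dot x r v.
have ig := tame_integrable tg.
have : I = - I.
  rewrite -mulN1r /I -RintegralZl//; last exact: measurable_eball.
  rewrite /Rintegral; congr fine.
  have xyx y : (x + x) - y - x = x - y by rewrite addrAC addrK.
  have refl y : eball x r ((x + x) - y) = eball x r y.
    by rewrite /eball/= xyx enormB.
  have gr y : g ((x + x) - y) = -1 * g y.
    by rewrite /g xyx -(opprB y x) dotNr mulN1r.
  have pB : (fun y => (x + x) - y) @^-1` eball x r = eball x r.
    by apply/funext => y /=; rewrite /preimage/= refl.
  transitivity (\int[pushforward mu (fun y => (x + x) - y)%R]_(y in eball x r) (g y)%:E)%E.
    apply: eq_measure_integral => [|mr B mB _]; first exact: measurable_refl.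
    by rewrite -[LHS](mu_refl (x + x) mB).
  rewrite (@integral_pushforward _ _ _ _ _ _ (measurable_refl (x + x)))//.
  - by rewrite pB; apply: eq_integral => y _ /=; rewrite gr.
  - exact/measurable_EFinP.
  - rewrite pB; apply: eq_integrable (tame_integrable (tameZ (-1) tg)) => //.
      exact: measurable_eball.
    by move=> y _ /=; rewrite gr.
  - exact: measurable_eball.
by move=> H; lra.
Qed.

End Balls.
(** * Limits of means over converging balls *)

Section BallLimits.
Context {R : realType} {n : nat}.
Local Notation mu := (@lebesgue_measure_rV R n.+1).
Variables (x_ : nat -> 'rV[R]_n.+1) (x : 'rV[R]_n.+1) (r_ : nat -> R) (r : R).
Hypothesis x_x : enorm (x_ j - x) @[j --> \oo] --> (0 : R).
Hypothesis r_r : r_ j @[j --> \oo] --> r.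
Implicit Types y : 'rV[R]_n.+1.

Lemma near_in_eball y : eball x r y -> \forall j \near \oo, eball (x_ j) (r_ j) y.
Proof.
move=> xy; have e0 : 0 < (r - enorm (y - x)) / 2.
  by rewrite divr_gt0// subr_gt0.
have /cvgrPdist_lt/(_ _ e0) x1 := x_x.
have /cvgrPdist_lt/(_ _ e0) r1 := r_r.
near=> j.
have : `|0 - enorm (x_ j - x)| < (r - enorm (y - x)) / 2 by near: j.
have : `|r - r_ j| < (r - enorm (y - x)) / 2 by near: j.
rewrite ltr_norml sub0r normrN (ger0_norm (enorm_ge0 _)) => /andP[? ?] ?.
rewrite /eball/= (le_lt_trans (enorm_tri y x (x_ j)))// (enormB x).
lra.
Unshelve. all: by end_near. Qed.

Lemma near_notin_eball y : r < enorm (y - x) ->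
  \forall j \near \oo, ~ eball (x_ j) (r_ j) y.
Proof.
move=> xy; have e0 : 0 < (enorm (y - x) - r) / 2.
  by rewrite divr_gt0// subr_gt0.
have /cvgrPdist_lt/(_ _ e0) x1 := x_x.
have /cvgrPdist_lt/(_ _ e0) r1 := r_r.
near=> j.
have : `|0 - enorm (x_ j - x)| < (enorm (y - x) - r) / 2 by near: j.
have : `|r - r_ j| < (enorm (y - x) - r) / 2 by near: j.
rewrite ltr_norml sub0r normrN (ger0_norm (enorm_ge0 _)) => /andP[? ?] ?.
rewrite /eball/= => yj.
have := enorm_tri y (x_ j) x; lra.
Unshelve. all: by end_near. Qed.

(** Spheres are null, so the indicators of the balls converge almost everywhere. *)
Lemma vol_cvg : vol (x_ j) (r_ j) @[j --> \oo] --> vol x r.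
Proof.
pose D := eball x (r + 2).
have mD : measurable D by exact: measurable_eball.
have mB j : measurable_fun D (fun y => (\1_(eball (x_ j) (r_ j)) y)%:E : \bar R).
  by apply/measurable_EFinP; exact: measurable_indic (measurable_eball _ _).
have mB0 : measurable_fun D (fun y => (\1_(eball x r) y)%:E : \bar R).
  by apply/measurable_EFinP; exact: measurable_indic (measurable_eball _ _).
have iD : mu.-integrable D (EFin \o cst (1 : R)).
  by apply: tame_integrable; exact: tame_cst.
have BB0 : {ae mu, forall y, D y ->
    (\1_(eball (x_ j) (r_ j)) y)%:E @[j --> \oo] --> (\1_(eball x r) y : R)%:E}.
  exists [set y | enorm (y - x) = r]; split.
  - rewrite (_ : [set y | _] = ~` eball x r `&` ~` [set y | r < enorm (y - x)]).
      apply: measurableI; apply: measurableC; first exact: measurable_eball.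
      apply: open_measurable_rV; rewrite openE => y /= xy; apply/nbhs_eballP.
      exists (enorm (y - x) - r); first by rewrite subr_gt0.
      move=> z yz; rewrite /= -(ltrD2l (enorm (z - y))) in yz *.
      have := enorm_tri y z x; rewrite (enormB y z) => ?.
      by rewrite /eball/= in yz; lra.
    apply/seteqP; split => y; rewrite /eball/=.
      by move=> ->; rewrite ltxx.
    by move=> [/negP + /negP]; rewrite -!leNgt => ? ?; apply/eqP; rewrite eq_le; apply/andP.
  - exact: mu_sphere.
  move=> y /= yD; apply: contrapT => /eqP; rewrite neq_lt => /orP[xy|xy];
    apply: yD => _; apply/cvg_EFin; first by apply: nearW.
  - apply: cvg_near_cst; have := near_in_eball xy; apply: filter_app; near=> j => jy.
    by rewrite /= !indicE !mem_set.
  - by apply: nearW.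
  apply: cvg_near_cst; have := near_notin_eball xy; apply: filter_app; near=> j => jy.
  rewrite /= !indicE !memNset// /eball/=; apply/negP; rewrite -leNgt; exact: ltW.
have BD : {ae mu, forall y (j : nat), D y ->
    (`|(\1_(eball (x_ j) (r_ j)) y)%:E : \bar R| <= 1%:E)%E}.
  apply: aeW => y j _; rewrite lee_fin indicE.
  by case: (_ \in _); rewrite /= ?normr1 ?normr0.
have [_ _ H] := dominated_convergence mD mB mB0 BB0 iD BD.
have {}H : fine (mu (eball (x_ j) (r_ j) `&` D)) @[j --> \oo] --> vol x r.
  apply: fine_cvg; rewrite -volE (_ : eball x r = eball x r `&` D); last first.
    apply/esym/setIidl => y xy; rewrite /D /eball/= (lt_trans xy)// ltrDl//.
  rewrite -integral_indic//; last exact: measurable_eball.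
  apply: cvg_trans H; apply: near_eq_cvg; apply: nearW => j /=.
  by rewrite integral_indic//; exact: measurable_eball.
apply: cvg_trans H; apply: near_eq_cvg.
have /cvgrPdist_lt/(_ _ ltr01) x1 := x_x.
have /cvgrPdist_lt/(_ _ ltr01) r1 := r_r.
near=> j; rewrite /vol; congr (fine (mu _)); apply/setIidl => y yj.
have : `|0 - enorm (x_ j - x)| < 1 by near: j.
have : `|r - r_ j| < 1 by near: j.
rewrite ltr_norml sub0r normrN (ger0_norm (enorm_ge0 _)) => /andP[? ?] ?.
rewrite /D /eball/= in yj *; have := enorm_tri y (x_ j) x; lra.
Unshelve. all: by end_near. Qed.

Variables (g_ : nat -> 'rV[R]_n.+1 -> R) (g : 'rV[R]_n.+1 -> R) (C : R).
Hypothesis r0 : 0 < r.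
Hypothesis r_0 : forall j, 0 < r_ j.
Hypothesis mg_ : forall j, measurable_fun (eball (x_ j) (r_ j)) (g_ j).
Hypothesis mg : measurable_fun (eball x r) g.
Hypothesis g_C : forall j y, eball (x_ j) (r_ j) y -> `|g_ j y| <= C.
Hypothesis gC : forall y, eball x r y -> `|g y| <= C.
Hypothesis g_g : forall y, eball x r y -> forall e, 0 < e ->
  \forall j \near \oo, g_ j y <= g y + e.

Lemma tame_subC A (h : 'rV[R]_n.+1 -> R) : tame A h -> tame A (fun y => C - h y).
Proof.
by move=> th; have := tameD (tame_cst A C) (tameN th).
Qed.

(** Fatou's lemma, for the nonnegative functions [C - g_ j] extended by zero: a
    point of the limit ball lies in all but finitely many of the balls. *)
Lemma fatou_ball e : 0 < e -> \forall j \near \oo,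
  \int[mu]_(y in eball x r) (C - g y) - e <=
  \int[mu]_(y in eball (x_ j) (r_ j)) (C - g_ j y).
Proof.
move=> e0.
have tg : tame (eball x r) (fun y => C - g y).
  by apply: tame_subC; split => //; exists C.
have tg_ j : tame (eball (x_ j) (r_ j)) (fun y => C - g_ j y).
  by apply: tame_subC; split => //; exists C => y; exact: g_C.
pose F j := (fun y => (C - g_ j y)%:E) \_ (eball (x_ j) (r_ j)).
have mF j : measurable_fun setT (F j).
  apply/(measurable_restrictT _ _).1; first exact: measurable_eball.
  by apply/measurable_EFinP; exact: (tg_ j).1.
have F0 j y : setT y -> (0 <= F j y)%E.
  move=> _; rewrite /F patchE; case: ifPn => //; rewrite inE => /g_C.
  by rewrite lee_fin subr_ge0 ler_norml => /andP[].
have := fatou mu measurableT mF F0.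
have FE j : (\int[mu]_y F j y = (\int[mu]_(y in eball (x_ j) (r_ j)) (C - g_ j y))%:E)%E.
  rewrite -integral_mkcond /Rintegral fineK//.
  exact: (integrable_fin_num (measurable_eball _ _) (tame_integrable (tg_ j))).
have le1 : ((\int[mu]_(y in eball x r) (C - g y))%:E <=
    \int[mu]_y limn_einf (F^~ y))%E.
  rewrite /Rintegral fineK; last first.
    exact: (integrable_fin_num (measurable_eball _ _) (tame_integrable tg)).
  rewrite integral_mkcond; apply: ge0_le_integral => //.
  - move=> y _; rewrite patchE; case: ifPn => //; rewrite inE => /gC.
    by rewrite lee_fin subr_ge0 ler_norml => /andP[].
  - apply/(measurable_restrictT _ _).1; first exact: measurable_eball.
    by apply/measurable_EFinP; exact: tg.1.
  - rewrite (_ : (fun y => _) = (fun y => - limn_esup (fun j => - F j y))%E).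
      apply: measurableT_comp => //; apply: measurable_fun_limn_esup => j.
      by apply: measurableT_comp => //; exact: mF.
    by [].
  move=> y _; rewrite patchE; case: ifPn => [|_]; last first.
    by apply: ge_limn_einf; apply: nearW => j; exact: F0.
  rewrite inE => xy; apply/lee_addgt0Pr => d d0.
  rewrite -leeBlDr//; apply: ge_limn_einf.
  have := g_g xy d0; apply: filter_app; have := near_in_eball xy; apply: filter_app.
  near=> j => jy gj; rewrite /F patchE mem_set// lee_fin; lra.
move=> le2; have : ((\int[mu]_(y in eball x r) (C - g y) - e)%:E <
    limn_einf (fun j => \int[mu]_y F j y))%E.
  by apply: lt_le_trans (le_trans le1 le2); rewrite lte_fin gtrBl.
move=> /lt_limn_einf; apply: filter_app; near=> j; rewrite FE lte_fin; exact: ltW.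
Unshelve. all: by end_near. Qed.

Lemma avg_limsup e : 0 < e -> \forall j \near \oo,
  avg (x_ j) (r_ j) (g_ j) <= avg x r g + e.
Proof.
move=> e0.
have tg : tame (eball x r) g by split => //; exists C.
have tg_ j : tame (eball (x_ j) (r_ j)) (g_ j).
  by split => //; exists C => y; exact: g_C.
have avgC y s h : 0 < s -> tame (eball y s) h ->
    avg y s h = C - avg y s (fun y => C - h y).
  move=> s0 th; have := avgD (tame_cst (eball y s) C) (tameN th).
  rewrite avg_cst// avgN// /comp/= => ->; lra.
set I := \int[mu]_(y in eball x r) (C - g y).
have v0 := vol_gt0 x r0.
pose e' := e / 2 * vol x r.
have e'0 : 0 < e' by rewrite mulr_gt0// divr_gt0.
have vI : (vol (x_ j) (r_ j))^-1 * (I - e') @[j --> \oo] --> (vol x r)^-1 * (I - e').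
  apply: cvgMl; apply: cvgV; last exact: vol_cvg.
  by rewrite gt_eqF.
have /cvgrPdist_lt/(_ (e / 2)) := vI; rewrite divr_gt0// => /(_ isT).
apply: filter_app; have := fatou_ball e'0; apply: filter_app; near=> j => Ij.
rewrite ltr_norml => /andP[_ H].
rewrite (avgC _ _ _ (r_0 j))// (avgC _ _ _ r0)// /avg -/I.
have vj : 0 <= (vol (x_ j) (r_ j))^-1 by rewrite invr_ge0; exact/ltW/vol_gt0.
move: Ij H vj; rewrite -/I (_ : (vol x r)^-1 * (I - e') = (vol x r)^-1 * I - e / 2).
  set J := Rintegral _ (eball (x_ j) (r_ j)) _.
  set w := (vol (x_ j) (r_ j))^-1; set w0 := (vol x r)^-1.
  clearbody J w w0 I => Ij H w_ge0.
  by have := ler_wpM2l w_ge0 Ij; lra.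
by rewrite /e'; field; rewrite gt_eqF.
Unshelve. all: by end_near. Qed.

End BallLimits.
(** * Negative powers of the distance have the sub-mean value property *)

Section Bernoulli.
Context {R : realType}.
Implicit Types t a s : R.

Lemma bernoulli_ge a m : 0 <= a -> 1 + m%:R * (a - 1) <= a ^+ m.
Proof.
move=> a0; elim: m => [|m IH]; first by rewrite mul0r addr0 expr0.
rewrite exprS (le_trans _ (ler_wpM2l a0 IH))// -natr1.
have := mulr_ge0 (ler0n R m) (sqr_ge0 (a - 1)); lra.
Qed.

Lemma bernoulli2_ge s m : 0 <= s ->
  1 + m%:R * s + m%:R * (m%:R - 1) / 2 * s ^+ 2 <= (1 + s) ^+ m.
Proof.
move=> s0; elim: m => [|m IH]; first by rewrite !mul0r !addr0 expr0.
have s1 : 0 <= 1 + s by lra.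
rewrite [in leRHS]exprS (le_trans _ (ler_wpM2l s1 IH))// -natr1.
have : 0 <= m%:R * (m%:R - 1) * s ^+ 3.
  case: m {IH} => [|m]; first by rewrite !mul0r.
  by rewrite !mulr_ge0 ?exprn_ge0// subr_ge0 ler1n.
set M : R := m%:R; set S3 := s ^+ 3 => H.
rewrite -subr_ge0 [leRHS](_ : _ = (M * (M - 1) * s ^+ 3) / 2); last by field.
by rewrite divr_ge0.
Qed.

Lemma inv_ge1B t : -1 < t -> 1 - t <= (1 + t)^-1.
Proof.
move=> t1; have t0 : 0 < 1 + t by lra.
by rewrite -[leRHS]mul1r ler_pdivlMr//; have := sqr_ge0 t; lra.
Qed.

Lemma expV_ge1 t m : -1 < t -> 1 - m%:R * t <= (1 + t)^-1 ^+ m.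
Proof.
move=> t1; have t0 : 0 < 1 + t by lra.
apply: le_trans (bernoulli_ge m _); last by rewrite invr_ge0 ltW.
rewrite -mulrN lerD2l ler_wpM2l//; have := inv_ge1B t1; lra.
Qed.

Lemma expV_ge2 t m : -1 < t -> t <= 0 ->
  1 - m%:R * t + m%:R * (m%:R - 1) / 2 * t ^+ 2 <= (1 + t)^-1 ^+ m.
Proof.
move=> t1 t0; rewrite -mulrN -sqrrN.
apply: le_trans (bernoulli2_ge m _) _; first by rewrite oppr_ge0.
by apply: lerXn2r; rewrite ?nnegrE ?inv_ge1B//; have := inv_ge1B t1; lra.
Qed.

End Bernoulli.

Section Submean.
Context {R : realType} {n : nat}.
Local Notation mu := (@lebesgue_measure_rV R n).
Implicit Types (x y z : 'rV[R]_n) (r : R).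

Lemma continuous_enormB z : continuous (fun y => enorm (y - z)).
Proof.
move=> y A /nbhs_ballP[e /= e0 H]; apply/nbhs_eballP; exists e => // w wy.
apply: H; rewrite /eball/= in wy; rewrite /ball/= ltr_norml.
have := enorm_tri w y z; have := enorm_tri y w z; rewrite (enormB y w) => ? ?.
by apply/andP; split; lra.
Qed.

Definition rpow z m y : R := (enorm (y - z))^-1 ^+ (2 * m).

Lemma rpowE z m y : rpow z m y = (dot (y - z) (y - z))^-1 ^+ m.
Proof. by rewrite /rpow exprM exprVn sqr_enorm. Qed.

Lemma rpow_ge0 z m y : 0 <= rpow z m y.
Proof. by rewrite exprn_ge0// invr_ge0 enorm_ge0. Qed.

Lemma rpow_le z m y (a : R) : 0 < a -> a <= enorm (y - z) -> rpow z m y <= a^-1 ^+ (2 * m).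
Proof.
move=> a0 ay; apply: lerXn2r; rewrite ?nnegrE ?invr_ge0 ?enorm_ge0 ?(ltW a0)//.
by rewrite lef_pV2// posrE (lt_le_trans a0).
Qed.

Lemma rpow_ge z m y (a : R) : 0 < enorm (y - z) -> enorm (y - z) <= a ->
  a^-1 ^+ (2 * m) <= rpow z m y.
Proof.
move=> y0 ay; have a0 := lt_le_trans y0 ay.
apply: lerXn2r; rewrite ?nnegrE ?invr_ge0 ?enorm_ge0 ?(ltW a0)//.
by rewrite lef_pV2// posrE.
Qed.

Lemma eball_away x z r y : eball x r y -> enorm (x - z) - r < enorm (y - z).
Proof.
by rewrite /eball/= => xy; have := enorm_tri x y z; rewrite (enormB x y); lra.
Qed.

Lemma tame_rpow x z m r : r < enorm (x - z) -> tame (eball x r) (rpow z m).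
Proof.
move=> rxz; have rxz0 : 0 < enorm (x - z) - r by rewrite subr_gt0.
split; last first.
  exists ((enorm (x - z) - r)^-1 ^+ (2 * m)) => y /(@eball_away _ z) /ltW xy.
  by rewrite ger0_norm ?rpow_ge0// rpow_le.
apply: usc_on_measurable; first exact: open_eball.
suff /continuous_usc_on[] : {within eball x r, continuous (rpow z m)} by [].
apply: continuous_in_subspaceT => y; rewrite inE => /(@eball_away _ z) xy.
apply: (@cvg_comp _ _ _ (fun w => (enorm (w - z))^-1) (fun a => a ^+ (2 * m)) _
  (nbhs ((enorm (y - z))^-1))); last exact: exprn_continuous.
apply: cvgV; [exact: nbhs_filter| |exact: continuous_enormB].
by rewrite gt_eqF// (lt_trans rxz0).
Qed.

Lemma avg_indicE x r A : measurable A -> A `<=` eball x r ->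
  avg x r (\1_A) = fine (mu A) / vol x r.
Proof.
move=> mA AB; rewrite /avg mulrC; congr (_ / _).
rewrite /Rintegral integral_indic//; last exact: measurable_eball.
by rewrite setIidl.
Qed.

(** With [R = |x - z|] and [|y - z|^2 = R^2 (1 + t)], the power is
    [R^(-2m) (1 + t)^(-m)], and [(1 + t)^(-m) >= 1 - m t].  On average this costs
    at most [m (r / R)^2], the linear part of [t] being odd.  On the ball [G] of
    radius [r / 8] centred at distance [r / 2] from [x] towards [z] one has
    [t <= - r / (2 R)], and the second-order term gains
    [m (m - 1) / 8 (r / R)^2].  As [G] is a fixed proportion [k] of the whole ball,
    the gain wins for large [m], whatever the ratio [r / R < 1]. *)
Lemma submean_rpow x z r m (k : R) : 0 < k -> 0 < r -> r < enorm (x - z) ->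
  (forall y, k * vol x r <= vol y (r / 8)) -> 8 <= k * (m%:R - 1) ->
  rpow z m x <= avg x r (rpow z m).
Proof.
move=> k0 r0 rxz kvol km.
set e := enorm (x - z) in rxz *; have e0 : 0 < e by exact: lt_trans rxz.
pose d := r / e; have d0 : 0 < d by rewrite divr_gt0.
have d1 : d < 1 by rewrite ltr_pdivrMr// mul1r.
have rde : r = d * e by rewrite /d divfK// gt_eqF.
pose q := dot (x - z) (x - z).
have qe : q = e ^+ 2 by rewrite /q -sqr_enorm.
have q0 : 0 < q by rewrite qe exprn_gt0.
pose c := x - (d / 2) *: (x - z).
pose G := eball c (r / 8).
have GB : G `<=` eball x r.
  move=> y; rewrite /G /eball/= => yc.
  rewrite (le_lt_trans (enorm_tri y c x))//.
  rewrite {2}/c (addrC x) addrK enormN enormZ -/e ger0_norm ?divr_ge0 ?ltW//.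
  rewrite (_ : d / 2 * e = r / 2); last by rewrite rde; field.
  lra.
have mG : measurable G by exact: measurable_eball.
(* [R] is [e] here, and [d = r / R] *)
pose t y := (2 * dot (x - z) (y - x) + dot (y - x) (y - x)) / q.
have tE y : dot (y - z) (y - z) = q * (1 + t y).
  rewrite (_ : y - z = (y - x) + (x - z)); last by rewrite addrA subrK.
  rewrite dotDD (dotC (y - x)) -/q /t.
  by field; rewrite gt_eqF.
have t1 y : eball x r y -> -1 < t y.
  move=> /(@eball_away _ z) xy.
  have : 0 < dot (y - z) (y - z).
    by rewrite -sqr_enorm exprn_gt0// (lt_trans _ xy)// subr_gt0.
  by rewrite tE pmulr_rgt0//; lra.
have tG y : G y -> t y <= - (d / 2).
  move=> Gy; have yz : enorm (y - z) <= (1 - 3 / 8 * d) * e.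
    rewrite (le_trans (enorm_tri y c z))//.
    rewrite (_ : c - z = (1 - d / 2) *: (x - z)); last first.
      by rewrite scalerBl scale1r /c addrAC.
    rewrite enormZ -/e ger0_norm; last lra.
    by move: (ltW Gy); rewrite rde; lra.
  have : q * (1 + t y) <= q * (1 - 3 / 8 * d) ^+ 2.
    rewrite -tE -sqr_enorm qe mulrC -exprMn ler_sqr// ?nnegrE ?enorm_ge0//.
    by rewrite mulr_ge0 ?ltW//; lra.
  rewrite ler_pM2l// => H.
  have : d ^+ 2 <= d by rewrite expr2 ler_piMr// ltW.
  lra.
pose M : R := m%:R.
have M1 : 0 <= M - 1.
  have := le_trans (ltW (ltr0Sn R 7)) km; rewrite pmulr_rge0//.
pose lin y := - (2 * M / q) * dot (x - z) (y - x).
pose low y := (1 - M * d ^+ 2) + (lin y + M * (M - 1) / 8 * d ^+ 2 * \1_G y).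
have lowle y : eball x r y -> q^-1 ^+ m * low y <= rpow z m y.
  move=> xy; rewrite rpowE tE invfM exprMn ler_wpM2l ?exprn_ge0 ?invr_ge0 ?(ltW q0)//.
  have ty : M * t y <= M * d ^+ 2 - lin y.
    rewrite /lin /t (_ : _ - _ = M * (2 * dot (x - z) (y - x) / q + d ^+ 2)); last by ring.
    rewrite ler_wpM2l ?ler0n// mulrDl lerD2l ler_pdivrMr//.
    by rewrite qe -exprMn -rde -le_enorm ?ltW//.
  rewrite /low indicE; case: (boolP (y \in G)) => [/set_mem Gy|_] /=.
    have tyG := tG y Gy.
    have t0 : t y <= 0 by lra.
    apply: le_trans (expV_ge2 m (t1 y xy) t0).
    have : d ^+ 2 / 4 <= t y ^+ 2.
      rewrite (_ : d ^+ 2 / 4 = (d / 2) ^+ 2); last by field.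
      by rewrite -(sqrrN (t y)) ler_sqr ?nnegrE; lra.
    move=> /(ler_wpM2l (mulr_ge0 (ler0n R m) M1)); rewrite -/M; lra.
  by apply: le_trans (expV_ge1 m (t1 y xy)); rewrite -/M; lra.
have tlin : tame (eball x r) lin.
  exact: tameZ (tame_dot _ _ _).
have tind : tame (eball x r) (fun y => M * (M - 1) / 8 * d ^+ 2 * \1_G y).
  apply: tameZ; split; first exact: measurable_indic.
  by exists 1 => y _; rewrite indicE; case: (_ \in _); rewrite /= ?normr1 ?normr0.
have tlow : tame (eball x r) low.
  by apply: tameD (tame_cst _ _) (tameD tlin tind).
apply: le_trans (le_avg r0 (tameZ (q^-1 ^+ m) tlow) (tame_rpow m rxz) lowle).
rewrite avgZ// rpowE -/q ler_peMr ?exprn_ge0 ?invr_ge0 ?(ltW q0)//.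
rewrite (avgD (tame_cst _ _) (tameD tlin tind)) avg_cst//.
have lin0 : avg x r lin = 0.
  by rewrite /lin (avgZ _ (tame_dot _ _ _)) avg_odd mulr0.
rewrite (avgD tlin tind) lin0 add0r.
rewrite avgZ; last first.
  split; first exact: measurable_indic.
  by exists 1 => y _; rewrite indicE; case: (_ \in _); rewrite /= ?normr1 ?normr0.
rewrite avg_indicE// -[fine _]/(vol c (r / 8)).
have kv : k <= vol c (r / 8) / vol x r by rewrite ler_pdivlMr ?vol_gt0.
have : 8 <= vol c (r / 8) / vol x r * (M - 1).
  by rewrite (le_trans km)// ler_wpM2r.
have : 0 <= M / 8 * d ^+ 2 by rewrite mulr_ge0 ?divr_ge0 ?sqr_ge0 ?ler0n.
set w := _ / vol x r => H1 /(ler_wpM2l H1); lra.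
Qed.

End Submean.
(** * Compactness, semicontinuity and boundaries *)

Section Topology.
Context {R : realType} {n : nat}.
Implicit Types (x y z : 'rV[R]_n) (A K : set 'rV[R]_n) (e d : R).

Definition mesh (N : nat) : R := N.+1%:R^-1.

Lemma mesh_gt0 N : 0 < mesh N. Proof. by rewrite invr_gt0. Qed.

Lemma mesh_lt e : 0 < e -> exists N : nat, mesh N < e.
Proof.
by move=> e0; have [N] := ltr_add_invr e0; rewrite add0r => ?; exists N.
Qed.

Lemma mesh_le N M : (N <= M)%N -> mesh M <= mesh N.
Proof. by move=> NM; rewrite lef_pV2 ?posrE// ler_nat ltnS. Qed.

Lemma closure_eballP A x : closure A x <->
  forall e, 0 < e -> exists2 y, A y & enorm (y - x) < e.
Proof.
split=> [Ax e e0|H B /nbhs_eballP[e e0 xB]].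
  by have [y [Ay xy]] := Ax _ (nbhs_eball x e0); exists y.
by have [y Ay yx] := H e e0; exists y; split => //; exact: xB.
Qed.

Lemma open_eballP A x : open A -> A x -> exists2 e, 0 < e & eball x e `<=` A.
Proof. by move=> oA Ax; apply/nbhs_eballP; exact: open_nbhs_nbhs. Qed.

(** Compactness in the form used for limits: eventual validity near each point of
    a compact set is eventual validity on the set. *)
Lemma compact_uniform K (P : nat -> 'rV[R]_n -> Prop) : compact K ->
  (forall x, K x -> exists2 d, 0 < d & exists N, forall M y, (N <= M)%N ->
     K y -> enorm (y - x) < d -> P M y) ->
  exists N, forall M y, (N <= M)%N -> K y -> P M y.
Proof.
move=> /compact_near_coveringP/near_covering_withinP cK loc.
have [|N _ HN] := cK nat \oo P _.
  move=> x /loc[d d0 [N HN]]; exists (eball x d, [set M | (N <= M)%N]).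
    by split; [exact: nbhs_eball|exists N].
  by move=> [y M] /= [yx NM] Ky; exact: HN.
by exists N => M y NM; exact: HN.
Qed.

(** If the supremum were not attained, compactness would bound the function away
    from it. *)
Lemma usc_max K (g : 'rV[R]_n -> R) (C : R) : compact K -> K !=set0 ->
  (forall x, K x -> g x <= C) -> usc_on K g ->
  exists2 x, K x & forall y, K y -> g y <= g x.
Proof.
move=> cK [x0 Kx0] gC gu; apply: contrapT => nmax.
pose s := sup [set g x | x in K].
have gs x : K x -> g x <= s.
  by move=> Kx; apply: ub_le_sup; [exists C => _ [y Ky <-]; exact: gC|exists x].
have lts x : K x -> g x < s.
  move=> Kx; rewrite lt_neqAle gs// andbT; apply/eqP => gxs.
  by apply: nmax; exists x => // y Ky; rewrite gxs gs.
have [x Kx|N HN] := @compact_uniform K (fun N y => g y <= s - mesh N) cK.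
  have e0 : 0 < (s - g x) / 2 by rewrite divr_gt0// subr_gt0 lts.
  have [d d0 H] := gu x Kx _ e0; exists d => //.
  have [N Ne] := mesh_lt e0; exists N => M y NM Ky yx.
  have := H y Ky yx; have := mesh_le NM; lra.
have : s <= s - mesh N.
  apply: ge_sup; first by exists (g x0), x0.
  by move=> _ [y Ky <-]; exact: HN.
have := mesh_gt0 N; lra.
Qed.

Lemma boundary_openE A : open A -> boundary A = closure A `\` A.
Proof. by rewrite /boundary => /interior_id ->. Qed.

Lemma closure_open_cases A x : open A -> closure A x -> A x \/ boundary A x.
Proof.
move=> oA cAx; rewrite boundary_openE//.
by have [Ax|nAx] := pselect (A x); [left|right].
Qed.

Lemma boundary_closure A : boundary A `<=` closure A.
Proof. by move=> x []. Qed.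

Lemma dist_set_le A x y : A y -> dist_set x A <= enorm (x - y).
Proof.
move=> Ay; apply: ge_inf; last by exists y.
by exists 0 => _ [z _ <-]; exact: enorm_ge0.
Qed.

(** A segment leaving an open set meets its boundary, by connectedness. *)
Lemma eball_sub_open A x (r : R) : open A -> A x -> r <= dist_set x (boundary A) ->
  eball x r `<=` A.
Proof.
move=> oA Ax rA y xy; apply: contrapT => nAy.
pose h (t : R) := x + t *: (y - x).
have hc : {within `[0, 1], continuous h}.
  apply: continuous_subspaceT => t.
  apply: cvgD; first exact: cvg_cst.
  by apply: cvgZr_tmp; exact: cvg_id.
have cS := connected_continuous_connected (@segment_connected R 0 1) hc.
have hx : (h @` `[0, 1]) x.
  by exists 0; rewrite /= ?in_itv/= ?lexx ?ler01// /h scale0r addr0.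
have hy : (h @` `[0, 1]) y.
  by exists 1; rewrite /= ?in_itv/= ?lexx ?ler01// /h scale1r addrC subrK.
have nb z : (h @` `[0, 1]) z -> ~ boundary A z.
  move=> [t /= ]; rewrite in_itv/= => /andP[t0 t1] <- /(dist_set_le x).
  rewrite /h opprD addrA subrr sub0r enormN enormZ ger0_norm// => H.
  have : t * enorm (y - x) <= 1 * enorm (y - x) by rewrite ler_wpM2r ?enorm_ge0.
  rewrite /eball/= in xy; lra.
suff hA : (h @` `[0, 1]) `&` A = h @` `[0, 1] by move: hy; rewrite -hA => -[].
apply: cS; first by exists x.
  by exists A.
exists (closure A); first exact: closed_closure.
apply/seteqP; split => z [hz Az]; split => //; first exact: subset_closure.
by case: (closure_open_cases oA Az) => // /(nb _ hz).
Qed.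

End Topology.
(** * The operator *)

Section Operator.
Context {R : realType} {n : nat}.
Implicit Types (x y z : 'rV[R]_n.+1) (e d s : R) (g h u U V : 'rV[R]_n.+1 -> R).

Lemma fun_oppK u : \- (\- u) = u.
Proof. by apply/funext => y /=; rewrite opprK. Qed.

Lemma sup_ball_le x r u s : 0 < r -> (forall y, eball x r y -> u y <= s) ->
  sup [set u y | y in eball x r] <= s.
Proof.
move=> r0 us; apply: ge_sup; first by exists (u x), x => //; exact: eball_center.
by move=> _ [y xy <-]; exact: us.
Qed.

Lemma tame_has_lbound A u : tame A u -> has_lbound [set u y | y in A].
Proof.
move=> [_ [C uC]]; exists (- C) => _ [y Ay <-].
by have := uC y Ay; rewrite ler_norml => /andP[].
Qed.

Lemma tame_has_ubound A u : tame A u -> has_ubound [set u y | y in A].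
Proof.
move=> [_ [C uC]]; exists C => _ [y Ay <-].
by have := uC y Ay; rewrite ler_norml => /andP[].
Qed.

Lemma le_sup_ball x r u y : tame (eball x r) u -> eball x r y ->
  u y <= sup [set u y | y in eball x r].
Proof. by move=> /tame_has_ubound tu xy; apply: ub_le_sup => //; exists y. Qed.

Lemma inf_ball_le x r u y : tame (eball x r) u -> eball x r y ->
  inf [set u y | y in eball x r] <= u y.
Proof. by move=> /tame_has_lbound tu xy; apply: ge_inf => //; exists y. Qed.

Lemma infN_ball A u : inf [set - u y | y in A] = - sup [set u y | y in A].
Proof.
rewrite /inf; congr (- sup _); apply/seteqP; split => [_ [_ [y Ay <-] <-]|_ [y Ay <-]].
  by exists y; rewrite ?opprK.
by exists (- u y); [exists y|rewrite opprK].
Qed.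

Lemma supN_ball A u : sup [set - u y | y in A] = - inf [set u y | y in A].
Proof.
rewrite /inf opprK; congr sup; apply/seteqP; split => [_ [y Ay <-]|_ [_ [y Ay <-] <-]].
  by exists (u y) => //; exists y.
by exists y.
Qed.

Variables (Omega : set 'rV[R]_n.+1) (rho : 'rV[R]_n.+1 -> R) (p : R).
Hypothesis oO : open Omega.
Hypothesis bO : bounded_set Omega.
Hypothesis p2 : 2 <= p.
Hypothesis rhoC : {within closure Omega, continuous rho}.
Hypothesis rho_adm : admissible_radius Omega rho.
Local Notation K := (closure Omega).
Local Notation B x := (eball x (rho x)).
Local Notation T := (pmean_op Omega rho p).

Definition wS : R := (p - 2) / (n.+1%:R + p).
Definition wM : R := (n.+1%:R + 2) / (n.+1%:R + p).

Lemma wS_ge0 : 0 <= wS.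
Proof.
by rewrite divr_ge0 ?subr_ge0// addr_ge0// (le_trans _ p2).
Qed.

Lemma wM_gt0 : 0 < wM.
Proof.
have p0 : 0 < p by rewrite (lt_le_trans _ p2).
by rewrite divr_gt0// addr_gt0.
Qed.

Lemma wSM : wS + wM = 1.
Proof.
have p0 : 0 < p by rewrite (lt_le_trans _ p2).
have d0 : n.+1%:R + p != 0 by rewrite gt_eqF// addr_gt0.
rewrite /wS /wM -mulrDl (_ : _ + _ = n.+1%:R + p) ?divff//.
ring.
Qed.

Lemma sub_closureO : Omega `<=` K. Proof. exact: subset_closure. Qed.

Lemma rho_gt0 x : Omega x -> 0 < rho x.
Proof. by case: rho_adm => _ + _ => /(_ x) /[apply] /andP[]. Qed.

Lemma ballO x : Omega x -> B x `<=` Omega.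
Proof.
move=> Ox; apply: eball_sub_open => //.
by case: rho_adm => _ /(_ x Ox)/andP[].
Qed.

Lemma ballK x : Omega x -> B x `<=` K.
Proof. by move=> Ox y /(ballO Ox) /sub_closureO. Qed.

Lemma rho_le_boundary x z : Omega x -> boundary Omega z -> rho x <= enorm (x - z).
Proof.
move=> Ox bz; apply: (le_trans _ (dist_set_le x bz)).
by case: rho_adm => _ /(_ x Ox)/andP[].
Qed.

Lemma boundary_notin x : boundary Omega x -> ~ Omega x.
Proof. by rewrite boundary_openE// => -[]. Qed.

Lemma rho_continuous x e : Omega x -> 0 < e -> exists2 d, 0 < d &
  forall y, Omega y -> enorm (y - x) < d -> `|rho y - rho x| < e.
Proof.
move=> Ox e0; have /within_continuous_eballP/(_ x) := rhoC.
move=> /(_ (sub_closureO Ox) e e0)[d d0 H]; exists d => // y Oy.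
exact: H (sub_closureO Oy).
Qed.

Lemma compact_closure_domain : compact K.
Proof.
apply: bounded_closed_compact; last exact: closed_closure.
have [M [Mr HM]] := bO; exists (M + 2); split; first exact: num_real.
move=> N MN x Kx; have [y [Oy xy]] := Kx _ (nbhsx_ballx x 1 ltr01).
have My : `|y| <= M + 1 by apply: HM => //; lra.
move: xy; rewrite -ball_normE /= => xy.
have := ler_normD (x - y) y; rewrite subrK; lra.
Qed.

Lemma pmeanE x u : Omega x -> T u x =
  wS * (2^-1 * sup [set u y | y in B x] + 2^-1 * inf [set u y | y in B x]) +
  wM * avg x (rho x) u.
Proof. by move=> Ox; rewrite /pmean_op /midrange_op /mean_op mem_set. Qed.

Lemma pmean_id x u : ~ Omega x -> T u x = u x.
Proof.
move=> nOx; rewrite /pmean_op /midrange_op /mean_op memNset// -/wS -/wM.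
by rewrite -mulrDl wSM mul1r.
Qed.

Lemma pmean_le x u a b c : Omega x -> sup [set u y | y in B x] <= a ->
  inf [set u y | y in B x] <= b -> avg x (rho x) u <= c ->
  T u x <= wS * (2^-1 * a + 2^-1 * b) + wM * c.
Proof.
move=> Ox ua ub uc; rewrite pmeanE// lerD ?ler_wpM2l ?wS_ge0 ?(ltW wM_gt0)//.
by lra.
Qed.

Lemma pmeanN x u : Omega x -> tame (B x) u -> T (\- u) x = - T u x.
Proof.
move=> Ox tu; rewrite !pmeanE// avgN// infN_ball supN_ball; ring.
Qed.

Lemma continuous_tame u : {within K, continuous u} -> forall x, Omega x ->
  tame (B x) u.
Proof.
move=> uC x Ox; split.
  apply: usc_on_measurable; first exact: open_eball.
  by apply: usc_onS (ballK Ox) _; have /continuous_usc_on[] := uC.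
have [C [_ HC]] := compact_bounded (continuous_compact uC compact_closure_domain).
exists (C + 1) => y /(ballK Ox) Ky; apply: HC; last by exists y.
by rewrite ltrDl.
Qed.

(** This is why the suprema over closed balls produced by half-relaxed limits can
    be compared with suprema over open balls. *)
Lemma lsc_closed_ball V x s : usc_on K (\- V) -> Omega x ->
  (forall y, B x y -> V y <= s) ->
  forall z, K z -> enorm (z - x) <= rho x -> V z <= s.
Proof.
move=> Vl Ox Vs z Kz zx; rewrite leNgt; apply/negP => sV.
have e0 : 0 < V z - s by rewrite subr_gt0.
have [d d0 H] := Vl z Kz _ e0.
have r0 := rho_gt0 Ox.
pose t := d / (d + rho x).
have dr0 : 0 < d + rho x by rewrite addr_gt0.
have t0 : 0 < t by rewrite divr_gt0.
have t1 : t < 1 by rewrite ltr_pdivrMr// mul1r ltrDl.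
have td : t * rho x < d.
  rewrite -(@ltr_pM2r _ (d + rho x))// mulrAC divfK ?gt_eqF//; last first.
  by rewrite mulrDr ltrDr mulr_gt0.
pose y := x + (1 - t) *: (z - x).
have yx : B x y.
  rewrite /eball/= /y (addrC x) addrK enormZ ger0_norm; last lra.
  rewrite (@le_lt_trans _ _ ((1 - t) * rho x))//.
    by rewrite ler_wpM2l//; lra.
  by rewrite gtr_pMl//; lra.
have yz : enorm (y - z) < d.
  rewrite (_ : y - z = (- t) *: (z - x)); last first.
    by apply/rowP => i; rewrite !mxE; ring.
  rewrite enormZ normrN ger0_norm ?(ltW t0)// (le_lt_trans _ td)//.
  by rewrite ler_wpM2l// ltW.
have := H y (ballK Ox yx) yz; have := Vs y yx => /=; lra.
Qed.

(** * Passage to the limit in the operator *)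

(** [relaxed_le g U]: [U] dominates the upper half-relaxed limit of the sequence
    [g], i.e. the limsup of [g k y] as [k] tends to infinity and [y] to [x]. *)
Definition relaxed_le (g : nat -> 'rV[R]_n.+1 -> R) U :=
  forall x, K x -> forall e, 0 < e -> exists N, forall k y, (N <= k)%N ->
    K y -> enorm (y - x) < mesh N -> g k y <= U x + e.

(** Eventually as [k] tends to infinity and [y] to [x] within the domain. *)
Definition joint_near x (P : nat -> 'rV[R]_n.+1 -> Prop) :=
  exists N, forall k y, (N <= k)%N -> Omega y -> enorm (y - x) < mesh N -> P k y.

Lemma joint_nearI x P Q :
  joint_near x P -> joint_near x Q -> joint_near x (fun k y => P k y /\ Q k y).
Proof.
move=> [N HN] [M HM]; exists (maxn N M) => k y; rewrite geq_max => /andP[Nk Mk] Oy yx.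
split; [apply: HN|apply: HM] => //; apply: (lt_le_trans yx);
  by apply: mesh_le; rewrite ?leq_maxl ?leq_maxr.
Qed.

Lemma joint_nearW x P Q : (forall k y, Omega y -> P k y -> Q k y) ->
  joint_near x P -> joint_near x Q.
Proof.
by move=> PQ [N HN]; exists N => k y Nk Oy yx; apply: PQ => //; exact: HN.
Qed.

Lemma joint_near_dist x d : 0 < d -> joint_near x (fun _ y => enorm (y - x) < d).
Proof.
by move=> /mesh_lt[N Nd]; exists N => k y _ _ /lt_trans; apply.
Qed.

Section KeyLemma.
Variables (g : nat -> 'rV[R]_n.+1 -> R) (U : 'rV[R]_n.+1 -> R) (C : R).
Hypothesis gcont : forall k, {within K, continuous (g k)}.
Hypothesis gC : forall k y, K y -> `|g k y| <= C.
Hypothesis Uusc : usc_on K U.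
Hypothesis UC : forall y, K y -> `|U y| <= C.
Hypothesis gU : relaxed_le g U.

Lemma usc_tame x : Omega x -> tame (B x) U.
Proof.
move=> Ox; split; last by exists C => y /(ballK Ox); exact: UC.
by apply: usc_on_measurable; [exact: open_eball|exact: usc_onS (ballK Ox) Uusc].
Qed.

(** Points outside the closed ball of [x] are outside the ball of [y] for [y] near
    [x]; at the other points, [relaxed_le] applies.  Compactness makes this
    uniform. *)
Lemma sup_limsup x s e : Omega x -> 0 < e ->
  (forall z, K z -> enorm (z - x) <= rho x -> U z <= s) ->
  joint_near x (fun k y => sup [set g k z | z in B y] <= s + e).
Proof.
move=> Ox e0 Us.
pose P N z := forall k y, (N <= k)%N -> Omega y -> enorm (y - x) < mesh N ->
  B y z -> g k z <= s + e.
have [z Kz|N HN] := @compact_uniform _ _ K P compact_closure_domain.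
  have [zx|xz] := leP (enorm (z - x)) (rho x).
    have [N HN] := gU Kz e0; exists (mesh N); first exact: mesh_gt0.
    exists N => M w NM Kw wz k y Mk Oy _ _.
    rewrite (le_trans (HN k w (leq_trans NM Mk) Kw wz))//.
    by rewrite lerD2r Us.
  have d0 : 0 < (enorm (z - x) - rho x) / 4 by rewrite divr_gt0// subr_gt0.
  have [d1 d10 H] := rho_continuous Ox d0.
  have m0 : 0 < Num.min d1 ((enorm (z - x) - rho x) / 4) by rewrite lt_min d10.
  exists ((enorm (z - x) - rho x) / 4) => //.
  have [N Nd] := mesh_lt m0; exists N => M w NM Kw wz k y Mk Oy yx.
  rewrite /eball/= => yw; exfalso.
  have {}yx := lt_trans (lt_le_trans yx (mesh_le NM)) Nd.
  move: yx; rewrite lt_min => /andP[/(H y Oy) + yx].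
  rewrite ltr_norml => /andP[_ rr].
  have := enorm_tri z w x; have := enorm_tri w y x; rewrite (enormB z w); lra.
exists N => k y Nk Oy yx; apply: sup_ball_le; first exact: rho_gt0.
by move=> z yz; exact: (HN N z (leqnn N) (ballK Oy yz) k y).
Qed.

(** A point of the open ball of [x] that nearly realizes the infimum of [U] belongs
    to the ball of [y] for [y] near [x]. *)
Lemma inf_limsup x e : Omega x -> 0 < e ->
  joint_near x (fun k y => inf [set g k z | z in B y] <= inf [set U z | z in B x] + e).
Proof.
move=> Ox e0; have e20 : 0 < e / 2 by rewrite divr_gt0.
have [_ [z xz <-] Uz] : exists2 a, [set U z | z in B x] a &
    a < inf [set U z | z in B x] + e / 2.
  apply: inf_adherent => //; split; last exact/tame_has_lbound/usc_tame.
  by exists (U x), x => //; exact/eball_center/rho_gt0.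
have [N HN] := gU (ballK Ox xz) e20.
have d0 : 0 < (rho x - enorm (z - x)) / 2 by rewrite divr_gt0// subr_gt0.
have [d1 d10 H] := rho_continuous Ox d0.
have H1 : joint_near x (fun k _ => (N <= k)%N).
  by exists N => k y Nk _ _.
have := joint_nearI H1 (joint_nearI (joint_near_dist x d10) (joint_near_dist x d0)).
apply: joint_nearW => k y Oy [Nk [yd1 yd]].
have yz : B y z.
  have := H y Oy yd1; rewrite ltr_norml => /andP[? _].
  by rewrite /eball/=; have := enorm_tri z x y; rewrite (enormB x); lra.
have ik := inf_ball_le (continuous_tame (@gcont k) Oy) yz.
rewrite (le_trans ik)//.
have := HN k z Nk (ballK Ox xz); rewrite subrr enorm0 mesh_gt0 => /(_ isT); lra.
Qed.

Lemma avg_joint_limsup x e : Omega x -> 0 < e ->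
  joint_near x (fun k y => avg y (rho y) (g k) <= avg x (rho x) U + e).
Proof.
move=> Ox e0; apply: contrapT => /forallNP H.
have {}H N : exists ky : nat * 'rV[R]_n.+1, [/\ (N <= ky.1)%N, Omega ky.2,
    enorm (ky.2 - x) < mesh N & avg x (rho x) U + e < avg ky.2 (rho ky.2) (g ky.1)].
  have /existsNP[k /existsNP[y]] := H N.
  move=> /not_implyP[Nk /not_implyP[Oy /not_implyP[yx /negP]]].
  by rewrite -ltNge => ?; exists (k, y).
have {}H := choice H; case: H => ky H.
have kyO j : Omega (ky j).2 by case: (H j).
have kyx : enorm ((ky j).2 - x) @[j --> \oo] --> (0 : R).
  apply/cvgrPdist_lt => d d0; have [N Nd] := mesh_lt d0.
  exists N => // j /= Nj; rewrite sub0r normrN ger0_norm ?enorm_ge0//.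
  by case: (H j) => _ _ /lt_trans + _; apply; rewrite (le_lt_trans (mesh_le Nj)).
have kyr : rho (ky j).2 @[j --> \oo] --> rho x.
  apply/cvgrPdist_lt => d d0; have [d1 d10 H1] := rho_continuous Ox d0.
  have /cvgrPdist_lt/(_ _ d10)[N _ HN] := kyx; exists N => // j /HN.
  by rewrite sub0r normrN ger0_norm ?enorm_ge0// distrC; exact: H1.
have [] := @avg_limsup _ _ (fun j => (ky j).2) x (fun j => rho (ky j).2) (rho x)
  kyx kyr (fun j => g (ky j).1) U C (rho_gt0 Ox) (fun j => rho_gt0 (kyO j))
  (fun j => (continuous_tame (@gcont _) (kyO j)).1) (usc_tame Ox).1 _ _ _ e e0.
- by move=> j y /(ballK (kyO j)); exact: gC.
- by move=> y /(ballK Ox); exact: UC.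
- move=> y xy d d0; have [N HN] := gU (ballK Ox xy) d0.
  exists N => // j /= Nj; apply: HN; last by rewrite subrr enorm0 mesh_gt0.
    by apply: (leq_trans Nj); case: (H j).
  exact: ballK Ox _ xy.
move=> N _ /(_ N (leqnn N)) /=.
by case: (H N) => _ _ _; rewrite ltNge => /negP.
Qed.

Lemma pmean_limsup x s e : Omega x -> 0 < e ->
  (forall z, K z -> enorm (z - x) <= rho x -> U z <= s) ->
  joint_near x (fun k y => T (g k) y <=
    wS * (2^-1 * s + 2^-1 * inf [set U z | z in B x]) + wM * avg x (rho x) U + e).
Proof.
move=> Ox e0 Us.
have := joint_nearI (sup_limsup Ox e0 Us)
  (joint_nearI (inf_limsup Ox e0) (avg_joint_limsup Ox e0)).
apply: joint_nearW => k y Oy [a1 [a2 a3]].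
apply: (le_trans (pmean_le Oy a1 a2 a3)).
by have := wSM; set i := inf _; set a := avg _ _ _ => w; nra.
Qed.

End KeyLemma.

Lemma continuous_bounded u : {within K, continuous u} ->
  exists C, forall x, K x -> `|u x| <= C.
Proof.
move=> uC.
have [C [_ HC]] := compact_bounded (continuous_compact uC compact_closure_domain).
exists (C + 1) => y Ky; apply: HC; last by exists y.
by rewrite ltrDl.
Qed.

Lemma continuousN u : {within K, continuous u} -> {within K, continuous (\- u)}.
Proof.
move=> /continuous_usc_on[u1 u2]; apply/continuous_usc_on; split => // x Kx e e0.
have [d d0 H] := u1 x Kx e e0; exists d => // y Ky yx.
by have := H y Ky yx; rewrite /= !opprK.
Qed.

(** In the domain this is [pmean_limsup] for a constant sequence; at a boundary point
    [xi], the ball of [y] is contained in the ball of radius [2 * |y - xi|] about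
    [xi]. *)
Lemma pmean_usc u : {within K, continuous u} -> usc_on K (T u).
Proof.
move=> uC x Kx e e0.
have [C uC'] := continuous_bounded uC.
have uu : usc_on K u by have /continuous_usc_on[] := uC.
have ul : usc_on K (\- u) by have /continuous_usc_on[] := uC.
have e20 : 0 < e / 2 by rewrite divr_gt0.
have [d d0 Hd] := uu x Kx _ e20.
have [Ox|bx] := closure_open_cases oO Kx; last first.
  exists (d / 2); first by rewrite divr_gt0.
  move=> y Ky yx; rewrite (pmean_id _ (boundary_notin bx)).
  have yxd : enorm (y - x) < d by lra.
  have [Oy|nOy] := pselect (Omega y); last first.
    by rewrite pmean_id//; have := Hd y Ky yxd; lra.
  have uy z : B y z -> u z <= u x + e / 2.
    move=> yz; apply/ltW/Hd; first exact: ballK Oy _ yz.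
    have := rho_le_boundary Oy bx; rewrite /eball/= in yz => ?.
    have := enorm_tri z y x; lra.
  have ty := continuous_tame uC Oy.
  have H1 : sup [set u z | z in B y] <= u x + e / 2.
    by apply: sup_ball_le => //; exact: rho_gt0.
  have H2 : inf [set u z | z in B y] <= u x + e / 2.
    have yy : B y y by apply/eball_center/rho_gt0.
    by rewrite (le_trans (inf_ball_le ty yy))// uy.
  have H3 : avg y (rho y) u <= u x + e / 2.
    rewrite -[leRHS](avg_cst y _ (rho_gt0 Oy)).
    by apply: le_avg => //; [exact: rho_gt0|exact: tame_cst].
  apply: (le_lt_trans (pmean_le Oy H1 H2 H3)).
  by have := wSM; nra.
have gu : relaxed_le (fun=> u) u.
  move=> z Kz a a0; have [b b0 Hb] := uu z Kz a a0.
  have [N Nb] := mesh_lt b0; exists N => k y _ Ky yz.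
  by apply/ltW/Hb => //; exact: lt_trans Nb.
have us z : K z -> enorm (z - x) <= rho x -> u z <= sup [set u z | z in B x].
  apply: lsc_closed_ball => // y xy; apply: le_sup_ball => //.
  exact: continuous_tame.
have [N HN] := @pmean_limsup (fun=> u) u C (fun=> uC) (fun=> uC') uu uC' gu x _ _ Ox e20 us.
have [r r0 xr] := open_eballP oO Ox.
exists (Num.min r (mesh N)); first by rewrite lt_min r0 mesh_gt0.
move=> y Ky; rewrite lt_min => /andP[/xr Oy yN].
apply: (le_lt_trans (HN N y (leqnn N) Oy yN)).
by rewrite -pmeanE// ltrD2l; lra.
Qed.

Lemma pmean_continuous u : {within K, continuous u} -> {within K, continuous (T u)}.
Proof.
move=> uC; apply/continuous_usc_on; split; first exact: pmean_usc.
have E x : K x -> T (\- u) x = (\- T u) x.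
  move=> Kx; have [Ox|nOx] := pselect (Omega x).
    by rewrite pmeanN//; exact: continuous_tame.
  by rewrite /= !pmean_id.
move=> x Kx e e0; have [d d0 H] := pmean_usc (continuousN uC) Kx e0.
by exists d => // y Ky yx; rewrite -!E//; exact: H.
Qed.

(** * Comparison *)

(** Semicontinuous subsolutions.  On the closed ball the supremum of [U] is only
    bounded by [s]; this is what passes to half-relaxed limits. *)
Definition subsolution U :=
  [/\ usc_on K U, exists C : R, forall x, K x -> `|U x| <= C &
    forall x s, Omega x -> (forall z, K z -> enorm (z - x) <= rho x -> U z <= s) ->
      U x <= wS * (2^-1 * s + 2^-1 * inf [set U z | z in B x]) +
             wM * avg x (rho x) U].

Lemma subsolution_tame U x : subsolution U -> Omega x -> tame (B x) U.
Proof. by move=> [uU [C UC] _] Ox; exact: usc_tame uU UC _ Ox. Qed.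

(** Semicontinuity turns a strict inequality at one point into one on a small ball,
    which has positive volume. *)
Lemma avg_max x r (g : 'rV[R]_n.+1 -> R) M : 0 < r -> usc_on (eball x r) g ->
  tame (eball x r) g -> (forall y, eball x r y -> g y <= M) ->
  M <= avg x r g -> forall y, eball x r y -> g y = M.
Proof.
move=> r0 gu gt gM Mavg y xy; apply/eqP; rewrite eq_le gM//= leNgt; apply/negP => gy.
pose e := (M - g y) / 2; have e0 : 0 < e by rewrite divr_gt0// subr_gt0.
have [d d0 Hd] := gu y xy e e0.
have [d' d'0 yd'] := open_eballP (@open_eball _ _ x r) xy.
pose G := eball y (Num.min d d').
have GB : G `<=` eball x r.
  by move=> z; rewrite /G /eball/= lt_min => /andP[_]; exact: yd'.
have mG : measurable G by exact: measurable_eball.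
have tG : tame (eball x r) (\1_G : _ -> R).
  split; first exact: measurable_indic.
  by exists 1 => z _; rewrite indicE; case: (_ \in _); rewrite /= ?normr1 ?normr0.
have tr := tameD (tame_cst (eball x r) M) (tameZ (- e) tG).
have : avg x r g <= avg x r (cst M \+ (fun z => - e * \1_G z)).
  apply: le_avg => // z xz /=; rewrite indicE; case: (boolP (z \in G)) => [/set_mem Gz|_].
    have : g z < g y + e by apply: Hd => //; move: Gz; rewrite /G /eball/= lt_min => /andP[].
    by rewrite mulr1 /e; lra.
  by rewrite mulr0 addr0 gM.
rewrite (avgD (tame_cst _ _) (tameZ _ tG)) avg_cst// avgZ// avg_indicE//.
have vG : 0 < fine (lebesgue_measure_rV n.+1 G) / vol x r.
  by rewrite divr_gt0 ?vol_gt0// lt_min d0.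
have := mulr_gt0 e0 vG; lra.
Qed.

Definition basis_vec0 : 'rV[R]_n.+1 := \row_i (i == ord0)%:R.

Lemma enorm_basis_vec0 : enorm basis_vec0 = 1.
Proof.
apply/eqP; rewrite -(@eqrXn2 _ 2)// ?enorm_ge0// sqr_enorm expr1n.
rewrite /dot big_ord_recl !mxE eqxx mulr1 big1 ?addr0// => i _.
by rewrite !mxE mul0r.
Qed.

(** Comparison principle: at a maximum point of [U - V] the mean-value terms
    force [U - V] to be maximal on a whole ball, which is impossible at a
    maximum point with largest first coordinate. *)
Lemma comparison U V : subsolution U -> subsolution (\- V) ->
  (forall x, boundary Omega x -> U x <= V x) -> forall x, K x -> U x <= V x.
Proof.
move=> sU sV bUV x Kx; rewrite leNgt; apply/negP => VUx.
have [uU [C UC] HU] := sU; have [uV [D VD] HV] := sV.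
pose w y := U y - V y.
have uw : usc_on K w.
  move=> y Ky e e0; have e20 : 0 < e / 2 by rewrite divr_gt0.
  have [d d0 Hd] := uU y Ky _ e20; have [d' d'0 Hd'] := uV y Ky _ e20.
  exists (Num.min d d'); first by rewrite lt_min d0.
  move=> z Kz; rewrite lt_min => /andP[/(Hd z Kz) + /(Hd' z Kz)/=].
  by rewrite /w; lra.
have wC y : K y -> w y <= C + D.
  move=> Ky; have := UC y Ky; have := VD y Ky.
  by rewrite /w /= normrN !ler_norml => /andP[? ?] /andP[? ?]; lra.
have [y0 Ky0 wy0] := usc_max compact_closure_domain (ex_intro _ x Kx) wC uw.
set M := w y0 in wy0.
have M0 : 0 < M by apply: lt_le_trans (wy0 x Kx); rewrite /w subr_gt0.
pose K' := [set y | K y /\ M <= w y].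
have cK' : compact K'.
  apply: (subclosed_compact _ compact_closure_domain) => [|y []//].
  move=> y /closure_eballP Hy; have Ky : K y.
    apply: closed_closure.
    by apply/closure_eballP => e /Hy[z [Kz _] zy]; exists z.
  split => //; rewrite leNgt; apply/negP => wyM.
  have e0 : 0 < M - w y by rewrite subr_gt0.
  have [d d0 Hd] := uw y Ky _ e0; have [z [Kz Mz] zy] := Hy d d0.
  by have := Hd z Kz zy; lra.
have uc : {within K, continuous (fun y => y 0 ord0)}.
  apply/within_continuous_eballP => y _ e e0; exists e => // z _ zy.
  have := coord_le_enorm (z - y) ord0; rewrite !mxE => /le_lt_trans; exact.
have [c0 Hc0] := continuous_bounded uc.
have [||x0 [Kx0 Mx0] x0max] := @usc_max _ _ K' (fun y => y 0 ord0) c0 cK'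
    (ex_intro _ y0 (conj Ky0 (lexx _))).
- by move=> y [/Hc0 + _]; exact/le_trans/ler_norm.
- apply: (@usc_onS _ _ _ K); first by move=> y [].
  by have /continuous_usc_on[] := uc.
have Ox0 : Omega x0.
  have [//|/bUV] := closure_open_cases oO Kx0; rewrite /w in Mx0; lra.
have UVM y : K y -> U y <= V y + M by move=> /wy0; rewrite /w; lra.
have tU := subsolution_tame sU Ox0; have tV := subsolution_tame sV Ox0.
have tV' : tame (B x0) V.
  by rewrite -(fun_oppK V); exact: tameN.
pose sV' := sup [set V y | y in B x0]; pose iU := inf [set U y | y in B x0].
have H1 : U x0 <= wS * (2^-1 * (M + sV') + 2^-1 * iU) + wM * avg x0 (rho x0) U.
  apply: HU => // z Kz zx; rewrite (le_trans (UVM z Kz))// addrC lerD2l.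
  apply: (lsc_closed_ball uV Ox0) zx => // y xy; exact: le_sup_ball.
have H2 : - V x0 <= wS * (2^-1 * (M - iU) - 2^-1 * sV') - wM * avg x0 (rho x0) V.
  have := HV x0 (M - iU) Ox0; rewrite infN_ball avgN// -!mulrN; apply.
  move=> z Kz zx; have : - U z <= - iU.
    apply: (@lsc_closed_ball (\- U) x0 _ _ Ox0) zx => //.
      by rewrite fun_oppK.
    by move=> y xy; rewrite /= lerN2; exact: inf_ball_le.
  by have := UVM z Kz => /=; lra.
have aw : avg x0 (rho x0) w = avg x0 (rho x0) U - avg x0 (rho x0) V.
  by rewrite -avgN// -avgD.
have Maw : M <= avg x0 (rho x0) w.
    rewrite -(ler_pM2l wM_gt0) aw.
  have wSE : wS = 1 - wM by rewrite -wSM addrK.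
  move: Mx0 H1 H2; rewrite /w wSE.
  set a := avg _ _ U; set b := avg _ _ V; lra.
have r0 := rho_gt0 Ox0.
have wB := avg_max r0 (usc_onS (ballK Ox0) uw) (tameD tU tV) (fun y By => wy0 y (ballK Ox0 By)) Maw.
pose x1 := x0 + (rho x0 / 2) *: basis_vec0.
have Bx1 : B x0 x1.
  rewrite /eball/= /x1 addrC addKr enormZ enorm_basis_vec0 mulr1 ger0_norm ?divr_ge0 ?ltW//.
  lra.
have := x0max x1 (conj (ballK Ox0 Bx1) _); rewrite (wB x1 Bx1) lexx => /(_ isT).
rewrite /x1 !mxE eqxx mulr1; lra.
Qed.

(** * The upper half-relaxed limit *)

Section RelaxedLimit.
Variables (g : nat -> 'rV[R]_n.+1 -> R) (C : R).
Hypothesis gcont : forall k, {within K, continuous (g k)}.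
Hypothesis gC : forall k y, K y -> `|g k y| <= C.

Definition tail N x : set R :=
  [set a | exists k y, [/\ (N <= k)%N, K y, enorm (y - x) < mesh N & a = g k y]].

(** The limsup of [g k y] as [k] tends to infinity and [y] to [x] within [K]. *)
Definition ulim x : R := inf [set sup (tail N x) | N in [set: nat]].

Lemma tail_ub N x : has_ubound (tail N x).
Proof.
by exists C => _ [k [y [_ Ky _ ->]]]; rewrite (le_trans (ler_norm _))// gC.
Qed.

Lemma tail_self N k x : K x -> (N <= k)%N -> tail N x (g k x).
Proof. by move=> Kx Nk; exists k, x; rewrite subrr enorm0 mesh_gt0. Qed.

Lemma sup_tail_le N x : K x -> sup (tail N x) <= C.
Proof.
move=> Kx; apply: ge_sup; first by exists (g N x); exact: tail_self.
by move=> _ [k [y [_ Ky _ ->]]]; rewrite (le_trans (ler_norm _))// gC.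
Qed.

Lemma sup_tail_ge N x : K x -> - C <= sup (tail N x).
Proof.
move=> Kx; apply: (@le_trans _ _ (g N x)); last first.
  by apply: ub_le_sup; [exact: tail_ub|exact: tail_self].
by have := gC N Kx; rewrite ler_norml => /andP[].
Qed.

Lemma ulim_has_inf x : K x -> has_inf [set sup (tail N x) | N in [set: nat]].
Proof.
move=> Kx; split; first by exists (sup (tail 0 x)), 0.
by exists (- C) => _ [N _ <-]; exact: sup_tail_ge.
Qed.

Lemma ulim_le_tail N x : K x -> ulim x <= sup (tail N x).
Proof.
by move=> Kx; apply: ge_inf; [case: (ulim_has_inf Kx)|exists N].
Qed.

Lemma ulim_bounded x : K x -> `|ulim x| <= C.
Proof.
move=> Kx; rewrite ler_norml (le_trans (ulim_le_tail 0 Kx) (sup_tail_le 0 Kx)) andbT.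
apply: lb_le_inf; first by case: (ulim_has_inf Kx).
by move=> _ [N _ <-]; exact: sup_tail_ge.
Qed.

Lemma ulim_tail_lt x e : K x -> 0 < e -> exists N, sup (tail N x) < ulim x + e.
Proof.
move=> Kx e0; have [_ [N _ <-] ?] := inf_adherent e0 (ulim_has_inf Kx).
by exists N.
Qed.

Lemma ulim_relaxed : relaxed_le g ulim.
Proof.
move=> x Kx e e0; have [N HN] := ulim_tail_lt Kx e0; exists N => k y Nk Ky yx.
apply: le_trans (ltW HN); apply: ub_le_sup; first exact: tail_ub.
by exists k, y.
Qed.

Lemma ulim_usc : usc_on K ulim.
Proof.
move=> x Kx e e0; have [N HN] := ulim_tail_lt Kx e0.
exists (mesh (2 * N).+1); first exact: mesh_gt0.
have m2 : mesh N = mesh (2 * N).+1 + mesh (2 * N).+1 :> R.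
  have E : (2 * N).+2%:R = 2 * N.+1%:R :> R by rewrite -natrM mulnS.
  by rewrite /mesh E invfM; move: (N.+1%:R^-1) => a; lra.
move=> y Ky yx; apply: le_lt_trans HN.
apply: (le_trans (ulim_le_tail (2 * N).+1 Ky)).
apply: ge_sup; first by exists (g (2 * N).+1 y); exact: tail_self.
move=> _ [k [z [Nk Kz zy ->]]]; apply: ub_le_sup; first exact: tail_ub.
exists k, z; split => //.
  by apply: leq_trans Nk; rewrite mul2n -addnn leqW// leq_addr.
by rewrite m2 (le_lt_trans (enorm_tri z y x))// ltrD.
Qed.

Lemma ulim_approx x e N : K x -> 0 < e -> exists k y,
  [/\ (N <= k)%N, K y, enorm (y - x) < mesh N & ulim x - e < g k y].
Proof.
move=> Kx e0; have [_ [k [y [Nk Ky yx ->]]] H] : exists2 a, tail N x a & sup (tail N x) - e < a.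
  apply: sup_adherent => //; split; last exact: tail_ub.
  by exists (g N x); exact: tail_self.
by exists k, y; split => //; apply: le_lt_trans H; rewrite lerD2r ulim_le_tail.
Qed.

Hypothesis giter : forall k x, K x -> g k.+1 x = T (g k) x.

(** Indices shift by one: values of [g k.+1] close to [ulim x] are values of
    [T (g k)], which [pmean_limsup] bounds. *)
Lemma ulim_subsolution : subsolution ulim.
Proof.
split; [exact: ulim_usc|by exists C; exact: ulim_bounded|].
move=> x s Ox Us; apply/ler_addgt0Pr => e e0; have e20 : 0 < e / 2 by rewrite divr_gt0.
have Kx := sub_closureO Ox.
have [N HN] := pmean_limsup gcont gC ulim_usc ulim_bounded ulim_relaxed Ox e20 Us.
have [r r0 xr] := open_eballP oO Ox; have [M Mr] := mesh_lt r0.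
have [k' [y [kN Ky yx Uy]]] := ulim_approx (maxn N M).+1 Kx e20.
case: k' kN Uy => [//|k] kN Uy.
have NM : (maxn N M <= (maxn N M).+1)%N by [].
have yN : enorm (y - x) < mesh N.
  by apply: (lt_le_trans yx); apply: mesh_le; rewrite (leq_trans _ NM)// leq_maxl.
have yM : enorm (y - x) < r.
  apply: lt_trans Mr; apply: (lt_le_trans yx); apply: mesh_le.
  by rewrite (leq_trans _ NM)// leq_maxr.
have Nk : (N <= k)%N by move: kN; rewrite ltnS; apply: leq_trans; exact: leq_maxl.
have := HN k y Nk (xr y yM) yN; rewrite -giter//.
rewrite giter// in Uy *; lra.
Qed.

End RelaxedLimit.

(** * Boundary barriers *)

(** A function below [c - b |. - z|^(-2m)] on the ball of [x] is mapped by the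
    operator below the same bound at [x]: the midrange part is the arithmetic-
    geometric inequality, between the far end of the ball and the point at
    distance [R^2 / (R + r)] from [z], where [R] is the distance from [x] to [z]
    and [r] the radius. *)
Lemma pmean_le_rpow x z m k u c b : Omega x -> rho x < enorm (x - z) -> 0 < k ->
  (forall y, k * vol x (rho x) <= vol y (rho x / 8)) -> 8 <= k * (m%:R - 1) ->
  tame (B x) u -> 0 <= b -> (forall y, B x y -> u y <= c - b * rpow z m y) ->
  T u x <= c - b * rpow z m x.
Proof.
move=> Ox rxz k0 kvol km tu b0 ucb.
have r0 := rho_gt0 Ox.
set D := enorm (x - z) in rxz.
have D0 : 0 < D by exact: lt_trans rxz.
have Dr0 : 0 < D + rho x by rewrite addr_gt0.
have yz y : B x y -> 0 < enorm (y - z).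
  by move=> /(@eball_away _ _ x z); rewrite -/D => H; apply: lt_trans H; rewrite subr_gt0.
have far y : B x y -> (D + rho x)^-1 ^+ (2 * m) <= rpow z m y.
  move=> xy; apply: rpow_ge; first exact: yz.
  by have := enorm_tri y x z; rewrite /eball/= in xy; rewrite /D; lra.
pose ys := x - (rho x / (D + rho x)) *: (x - z).
have Bys : B x ys.
  rewrite /eball/= /ys (addrC x) addrK enormN enormZ -/D ger0_norm; last first.
    by rewrite divr_ge0// ltW.
  by rewrite mulrAC ltr_pdivrMr// ltr_pM2l//; lra.
have ysz : enorm (ys - z) = D ^+ 2 / (D + rho x).
  rewrite (_ : ys - z = (D / (D + rho x)) *: (x - z)); last first.
    apply/rowP => i; rewrite !mxE; field.
    by rewrite gt_eqF.
  by rewrite enormZ -/D ger0_norm ?divr_ge0 ?(ltW D0) ?(ltW Dr0)// expr2 mulrAC.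
set a1 := (D + rho x)^-1 ^+ (2 * m) in far.
have a2E : rpow z m ys = (D^-1 ^+ (2 * m)) ^+ 2 / a1.
  rewrite /rpow ysz /a1 [in RHS]exprAC -[X in _ = _ * X]exprVn -exprMn.
  congr (_ ^+ _); rewrite invrK; field.
  by rewrite !gt_eqF.
have px : rpow z m x = D^-1 ^+ (2 * m) by [].
have a10 : 0 < a1 by rewrite exprn_gt0// invr_gt0.
have amgm : 2 * rpow z m x <= a1 + rpow z m ys.
  rewrite a2E px -subr_ge0; set q := D^-1 ^+ _.
  have -> : a1 + q ^+ 2 / a1 - 2 * q = (a1 - q) ^+ 2 / a1.
    by field; rewrite gt_eqF.
  by rewrite divr_ge0 ?sqr_ge0// ltW.
have H1 : sup [set u y | y in B x] <= c - b * a1.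
  apply: sup_ball_le => // y xy; apply: (le_trans (ucb y xy)).
  by rewrite lerD2l lerN2 ler_wpM2l// far.
have H2 : inf [set u y | y in B x] <= c - b * rpow z m ys.
  by apply: (le_trans (inf_ball_le tu Bys)); exact: ucb.
have tp := tame_rpow m rxz.
have H3 : avg x (rho x) u <= c - b * rpow z m x.
  have tb := tameD (tame_cst (B x) c) (tameZ (- b) tp).
  have : avg x (rho x) u <= avg x (rho x) (cst c \+ (fun y => - b * rpow z m y)).
    by apply: le_avg => // y xy /=; rewrite mulNr; exact: ucb.
  rewrite (avgD (tame_cst _ _) (tameZ _ tp)) avg_cst// avgZ//.
  have := submean_rpow k0 r0 rxz kvol km => /(ler_wpM2l b0); lra.
apply: (le_trans (pmean_le Ox H1 H2 H3)).
have := ler_wpM2l b0 amgm => /(ler_wpM2l wS_ge0).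
have wME : wM = 1 - wS by rewrite -wSM addrC addKr.
rewrite wME; set a := rpow z m ys; set a' := rpow z m x; lra.
Qed.

(** The only consequence of the cone condition that the barriers use. *)
Definition exterior_balls := exists kappa s0 : R,
  [/\ 0 < kappa < 1, 0 < s0 & forall xi s, boundary Omega xi -> 0 < s < s0 ->
    exists2 z, enorm (z - xi) = s & forall x, K x -> kappa * s <= enorm (x - z)].

(** Otherwise the ball of [x] would come arbitrarily close to [z]. *)
Lemma exterior_radius x z (a : R) : Omega x -> 0 < a ->
  (forall y, K y -> a <= enorm (y - z)) -> rho x < enorm (x - z).
Proof.
move=> Ox a0 az; rewrite ltNge; apply/negP => xz.
have D0 : 0 < enorm (x - z) by rewrite (lt_le_trans a0)// az//; exact: sub_closureO.
have aD := az x (sub_closureO Ox).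
pose t := a / enorm (x - z) / 2.
have t0 : 0 < t by rewrite !divr_gt0.
have t1 : t <= 1 / 2 by rewrite ler_pM2r// ler_pdivrMr// mul1r.
pose y := x - (1 - t) *: (x - z).
have By : B x y.
  rewrite /eball/= /y (addrC x) addrK enormN enormZ ger0_norm; last lra.
  by apply: lt_le_trans xz; rewrite gtr_pMl//; lra.
have := az y (ballK Ox By); rewrite (_ : y - z = t *: (x - z)).
  rewrite enormZ ger0_norm ?(ltW t0)// /t mulrAC divfK ?gt_eqF//; lra.
by apply/rowP => i; rewrite !mxE; ring.
Qed.

Section Barrier.
Variables (g : nat -> 'rV[R]_n.+1 -> R) (C : R).
Hypothesis gcont : forall k, {within K, continuous (g k)}.
Hypothesis gC : forall k y, K y -> `|g k y| <= C.
Hypothesis giter : forall k x, K x -> g k.+1 x = T (g k) x.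
Hypothesis ext : exterior_balls.
Variables (xi : 'rV[R]_n.+1) (c : R).
Hypothesis bxi : boundary Omega xi.
Hypothesis g0c : exists2 d, 0 < d & forall x, K x -> enorm (x - xi) < d -> g 0 x <= c.

(** The bound is uniform in [k]; its neighbourhood may depend on [L]. *)
Definition bound_near L := exists2 d, 0 < d &
  forall k x, K x -> enorm (x - xi) < d -> g k x <= c + L.

(** The barrier [c' - b * |x - z|^(-2m)] is at least [c] on the closure of the domain
    and at least [c + L] at distance [3 s] or more from [xi].  So all iterates stay
    below it within [6 s] of [xi]: from a point within [3 s], the operator sees only
    points within [6 s], as the radius is at most the distance to [xi].  Within
    [s / 2] of [xi] the distance to [z] is at most [3 / 2 s], where the barrier is
    at most [c + theta * L]; homogeneity makes [theta] independent of [s]. *)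
Lemma barrier_step : exists2 theta, 0 <= theta < 1 &
  forall L, 0 <= L -> bound_near L -> bound_near (theta * L).
Proof.
have [kappa [s0 [/andP[kap0 kap1] s00 Hext]]] := ext.
have [k k0 kvol] := @vol_doubling R n.+1.
have [m km] : exists m : nat, 8 <= k * (m%:R - 1).
  exists (Num.truncn (8 / k)).+2; rewrite -(natr1 (Num.truncn (8 / k)).+1) addrK.
  by rewrite mulrC -ler_pdivrMr//; exact/ltW/truncnS_gt.
have m0 : (0 < m)%N.
  case: m km => // /le_trans => /(_ 0); rewrite sub0r mulrN1 oppr_le0 ltW// => /(_ isT).
  by rewrite lern0.
pose pw (a : R) := a^-1 ^+ (2 * m).
have pw_lt a b : 0 < a -> a < b -> pw b < pw a.
  move=> a0 ab; have b0 : 0 < b by exact: lt_trans ab.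
  by rewrite ltr_pXn2r ?muln_gt0 ?nnegrE ?invr_ge0 ?(ltW a0) ?(ltW b0)// ltf_pV2.
have pwM a b : pw (a * b) = pw a * pw b by rewrite /pw invfM exprMn.
have pk2 : pw 2 < pw kappa by apply: pw_lt => //; lra.
have p32 : pw 2 < pw (3 / 2) by apply: pw_lt; lra.
have pk32 : pw (3 / 2) < pw kappa by apply: pw_lt => //; lra.
have den : 0 < pw kappa - pw 2 by rewrite subr_gt0.
exists ((pw kappa - pw (3 / 2)) / (pw kappa - pw 2)).
  rewrite divr_ge0 ?subr_ge0 ?ltW//= ltr_pdivrMr// mul1r; lra.
move=> L L0 [d d0 gd]; have [d' d'0 g0d] := g0c.
pose s := Num.min (Num.min d d' / 6) (s0 / 2).
have s_gt0 : 0 < s by rewrite !lt_min !divr_gt0// lt_min d0.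
have sd : 6 * s <= Num.min d d'.
  by rewrite mulrC -ler_pdivlMr// ge_min lexx.
have ss0 : 0 < s < s0.
  rewrite s_gt0/= (@le_lt_trans _ _ (s0 / 2))//; first by rewrite ge_min lexx orbT.
  lra.
have [z zxi zext] := Hext xi s bxi ss0.
pose den' := pw (kappa * s) - pw (2 * s).
have ps : 0 < pw s by rewrite exprn_gt0// invr_gt0.
have den'E : den' = (pw kappa - pw 2) * pw s by rewrite /den' !pwM mulrBl.
have den'0 : 0 < den' by rewrite den'E mulr_gt0.
pose b := L / den'; have b0 : 0 <= b by rewrite divr_ge0// ltW.
have bL : b * den' = L by rewrite /b divfK// gt_eqF.
(* [b] and [c'] make the barrier [c] at distance [kappa * s] from [z], and [c + L]
   at distance [2 * s] *)
pose c' := c + b * pw (kappa * s).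
have W0 x : K x -> c <= c' - b * rpow z m x.
  move=> Kx; rewrite /c' -addrA lerDl subr_ge0 ler_wpM2l//.
  by apply: rpow_le; [rewrite mulr_gt0|exact: zext].
have W1 x : 3 * s <= enorm (x - xi) -> c + L <= c' - b * rpow z m x.
  move=> xxi; rewrite /c' -addrA lerD2l -bL /den' -mulrBr ler_wpM2l// lerD2l lerN2.
  apply: rpow_le; first by rewrite mulr_gt0.
  by have := enorm_tri x z xi; rewrite zxi; lra.
have key j x : K x -> enorm (x - xi) < 6 * s -> g j x <= c' - b * rpow z m x.
  elim: j x => [|j IH] x Kx xxi.
    apply: le_trans (W0 x Kx); apply: g0d => //; apply: (lt_le_trans xxi).
    by rewrite (le_trans sd)// ge_min lexx orbT.
  have [far|near] := leP (3 * s) (enorm (x - xi)).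
    apply: le_trans (W1 x far); apply: gd => //; apply: (lt_le_trans xxi).
    by rewrite (le_trans sd)// ge_min lexx.
  rewrite giter//; have [Ox|nOx] := pselect (Omega x); last by rewrite pmean_id// IH.
  have rxi := rho_le_boundary Ox bxi.
  have Bxi y : B x y -> enorm (y - xi) < 6 * s.
    by rewrite /eball/= => xy; have := enorm_tri y x xi; lra.
  apply: (@pmean_le_rpow x z m k) => //.
  - exact: (exterior_radius Ox (mulr_gt0 kap0 s_gt0) zext).
  - by move=> y; apply: kvol; exact: rho_gt0.
  - exact: continuous_tame.
  - by move=> y xy; apply: IH; [exact: ballK Ox _ xy|exact: Bxi].
exists (s / 2); first by rewrite divr_gt0.
move=> j x Kx xxi; apply: (le_trans (key j x Kx _)); first lra.
have : pw (3 / 2 * s) <= rpow z m x.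
  apply: rpow_ge; first by apply: lt_le_trans (zext x Kx); rewrite mulr_gt0.
  by have := enorm_tri x xi z; rewrite (enormB xi) zxi; lra.
move=> /(ler_wpM2l b0) H.
apply: (@le_trans _ _ (c' - b * pw (3 / 2 * s))); first by rewrite lerD2l lerN2.
rewrite /c' -addrA lerD2l -mulrBr !pwM -mulrBl le_eqVlt; apply/orP; left; apply/eqP.
rewrite /b den'E; field.
by rewrite !gt_eqF.
Qed.

Lemma barrier e : 0 < e -> bound_near e.
Proof.
move=> e0; have [theta /andP[t0 t1] step] := barrier_step.
pose L0 := `|C| + `|c|; have L00 : 0 <= L0 by rewrite addr_ge0.
have HL j : bound_near (theta ^+ j * L0).
  elim: j => [|j IH]; last by rewrite exprS -mulrA; apply: step => //; rewrite mulr_ge0// exprn_ge0.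
  exists 1 => // k x Kx _; rewrite expr0 mul1r.
  have := le_trans (ler_norm _) (gC k Kx); have := ler_norm C; have := ler_norm (- c).
  by rewrite normrN /L0; lra.
have : theta ^+ j @[j --> \oo] --> (0 : R) by apply: cvg_expr; rewrite ger0_norm.
have eL : 0 < e / (L0 + 1) by rewrite divr_gt0// ltr_wpDl.
move=> /cvgrPdist_lt/(_ _ eL)[N _ /(_ N (leqnn N))].
rewrite /= sub0r normrN ger0_norm ?exprn_ge0// => tN.
have [d d0 Hd] := HL N; exists d => // k x Kx xxi.
apply: (le_trans (Hd k x Kx xxi)); rewrite lerD2l.
move: tN; rewrite ltr_pdivlMr ?ltr_wpDl// => /ltW; apply: le_trans.
by rewrite ler_wpM2l ?exprn_ge0// lerDl.
Qed.

Lemma ulim_boundary : ulim g xi <= c.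
Proof.
apply/ler_addgt0Pr => e e0; have [d d0 Hd] := barrier e0.
have [N Nd] := mesh_lt d0.
have Kxi := boundary_closure bxi.
apply: (le_trans (ulim_le_tail gC N Kxi)).
apply: ge_sup; first by exists (g N xi); exact: tail_self.
move=> _ [k [y [_ Ky yx ->]]]; apply: Hd => //; exact: lt_trans Nd.
Qed.

End Barrier.

(** * Convergence of the iterates and uniqueness *)

Lemma pmean_ext u v : (forall y, K y -> u y = v y) ->
  forall x, K x -> T u x = T v x.
Proof.
move=> uv x Kx; have [Ox|nOx] := pselect (Omega x); last by rewrite !pmean_id// uv.
have E y : B x y -> u y = v y by move=> /(ballK Ox); exact: uv.
rewrite !pmeanE// (eq_imagel E) /avg (@eq_Rintegral _ _ _ _ _ v)//.
by move=> y; rewrite inE; exact: E.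
Qed.

Lemma pmean_ub u C : {within K, continuous u} -> (forall x, K x -> u x <= C) ->
  forall x, K x -> T u x <= C.
Proof.
move=> uC uc x Kx; have [Ox|nOx] := pselect (Omega x); last by rewrite pmean_id// uc.
have r0 := rho_gt0 Ox; have tu := continuous_tame uC Ox.
have uB y : B x y -> u y <= C by move=> /(ballK Ox); exact: uc.
have H1 := sup_ball_le r0 uB.
have H2 := le_trans (inf_ball_le tu (eball_center x r0)) (uc x Kx).
have H3 : avg x (rho x) u <= C.
  by rewrite -[leRHS](avg_cst x C r0); apply: le_avg => //; exact: tame_cst.
apply: (le_trans (pmean_le Ox H1 H2 H3)).
have wME : wM = 1 - wS by rewrite -wSM addrC addKr.
rewrite wME; lra.
Qed.

Lemma pmean_opp u : {within K, continuous u} -> forall x, K x -> T (\- u) x = - T u x.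
Proof.
move=> uC x Kx; have [Ox|nOx] := pselect (Omega x); last by rewrite !pmean_id.
by rewrite pmeanN//; exact: continuous_tame.
Qed.

Lemma pmean_bounded u C : {within K, continuous u} -> (forall x, K x -> `|u x| <= C) ->
  forall x, K x -> `|T u x| <= C.
Proof.
move=> uC uc x Kx; rewrite ler_norml lerNl -(pmean_opp uC Kx).
rewrite !pmean_ub//; [|exact: continuousN|] => y /uc; rewrite ler_norml => /andP[H1 H2] //=.
by rewrite lerNl.
Qed.

Lemma le_pmean_subsolution u : {within K, continuous u} ->
  (forall x, Omega x -> u x <= T u x) -> subsolution u.
Proof.
move=> uC uT; have uu : usc_on K u by have /continuous_usc_on[] := uC.
split=> //; first exact: continuous_bounded.
move=> x s Ox us; apply: (le_trans (uT x Ox)); apply: pmean_le => //.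
apply: sup_ball_le; first exact: rho_gt0.
by move=> y xy; apply: us; [exact: ballK Ox _ xy|exact: ltW].
Qed.

Lemma subsolution_le_pmean u : {within K, continuous u} -> subsolution u ->
  forall x, Omega x -> u x <= T u x.
Proof.
move=> uC [_ _ us] x Ox; rewrite pmeanE//; apply: us => //.
have ul : usc_on K (\- u) by have /continuous_usc_on[] := uC.
apply: lsc_closed_ball => // y xy; apply: le_sup_ball => //.
exact: continuous_tame.
Qed.

Lemma solution_unique f u v : dirichlet_solution Omega rho p f u ->
  dirichlet_solution Omega rho p f v -> forall x, K x -> u x <= v x.
Proof.
move=> [uC uT uf] [vC vT vf]; apply: comparison.
- by apply: le_pmean_subsolution => // x Ox; rewrite uT.
- apply: le_pmean_subsolution; first exact: continuousN.
  by move=> x Ox; rewrite (pmean_opp vC (sub_closureO Ox)) vT.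
- by move=> x bx; rewrite uf// vf.
Qed.

Lemma iterates_converge f u : exterior_balls -> {within K, continuous u} ->
  (forall x, boundary Omega x -> u x = f x) ->
  exists2 v, dirichlet_solution Omega rho p f v &
    forall e, 0 < e -> exists N, forall k x, (N <= k)%N -> K x ->
      `|iter k T u x - v x| < e.
Proof.
move=> ext uC uf; pose g k := iter k T u.
have gC k : {within K, continuous (g k)}.
  by elim: k => //= k IH; exact: pmean_continuous.
have [C uc] := continuous_bounded uC.
have gc k y : K y -> `|g k y| <= C.
  elim: k y => [|k IH] y Ky; first exact: uc.
  by apply: pmean_bounded.
have gi k x : K x -> g k.+1 x = T (g k) x by [].
have gb k x : boundary Omega x -> g k x = f x.
  move=> bx; elim: k => [|k IH]; first exact: uf.
  by rewrite gi ?pmean_id//; [exact: boundary_notin|exact: boundary_closure].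
pose h k := \- g k.
have hC k : {within K, continuous (h k)} by exact: continuousN.
have hc k y : K y -> `|h k y| <= C by move=> Ky; rewrite /h normrN gc.
have hi k x : K x -> h k.+1 x = T (h k) x.
  by move=> Kx; rewrite /h /= -(pmean_opp (gC k) Kx).
pose U := ulim g; pose W := ulim h.
have sU : subsolution U by exact: (ulim_subsolution gC gc gi).
have sW : subsolution W by exact: (ulim_subsolution hC hc hi).
have rU : relaxed_le g U by exact: (ulim_relaxed gc).
have rW : relaxed_le h W by exact: (ulim_relaxed hc).
have near_bd (w : 'rV[R]_n.+1 -> R) x : {within K, continuous w} ->
    boundary Omega x -> forall e, 0 < e ->
    exists2 d, 0 < d & forall y, K y -> enorm (y - x) < d -> w y <= w x + e.
  move=> /continuous_usc_on[wu _] bx e e0.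
  have [d d0 Hd] := wu x (boundary_closure bx) e e0.
  by exists d => // y Ky yx; exact/ltW/Hd.
have Uf x : boundary Omega x -> U x <= f x.
  move=> bx; apply/ler_addgt0Pr => e e0; rewrite -(gb 0%N x bx).
  exact: (ulim_boundary gC gc gi ext bx (near_bd _ _ (gC 0%N) bx e e0)).
have Wf x : boundary Omega x -> W x <= - f x.
  move=> bx; apply/ler_addgt0Pr => e e0; rewrite -(gb 0%N x bx).
  exact: (ulim_boundary hC hc hi ext bx (near_bd _ _ (hC 0%N) bx e e0)).
clearbody U W.
have UW x : K x -> U x = - W x.
  move=> Kx; apply/eqP; rewrite eq_le; apply/andP; split.
    apply: (@comparison U (\- W)) Kx => //; first by rewrite fun_oppK.
    by move=> y by_; rewrite (le_trans (Uf y by_))//= lerNr Wf.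
  apply/ler_addgt0Pr => e e0; have e20 : 0 < e / 2 by rewrite divr_gt0.
  have [N HN] := rU x Kx _ e20; have [M HM] := rW x Kx _ e20.
  have := HN (maxn N M) x (leq_maxl _ _) Kx.
  have := HM (maxn N M) x (leq_maxr _ _) Kx.
  rewrite subrr enorm0 !mesh_gt0 /h => /(_ isT) /= H1 /(_ isT) H2; lra.
have UC : {within K, continuous U}.
  apply/continuous_usc_on; split; first by case: sU.
  have [Wu _ _] := sW => x Kx e e0; have [d d0 Hd] := Wu x Kx e e0.
  by exists d => // y Ky yx; rewrite /= !UW// !opprK Hd.
have WC : {within K, continuous W}.
  apply/continuous_usc_on; split; first by case: sW.
  have [Uu _ _] := sU => x Kx e e0; have [d d0 Hd] := Uu x Kx e e0.
  by exists d => // y Ky yx; rewrite /= -!UW// Hd.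
exists U.
  split=> // x Hx.
    apply/eqP; rewrite eq_le (subsolution_le_pmean UC sU Hx) andbT.
    have Kx := sub_closureO Hx.
    have := subsolution_le_pmean WC sW Hx.
    rewrite (@pmean_ext W (\- U)) ?(pmean_opp UC)//; last first.
      by move=> y Ky /=; rewrite UW// opprK.
    by rewrite lerNr -UW.
  have Kx := boundary_closure Hx.
  by apply/eqP; rewrite eq_le Uf// UW//= lerNr Wf.
move=> e e0; apply: (compact_uniform (P := fun k x => `|g k x - U x| < e)) compact_closure_domain _.
move=> x Kx; have e40 : 0 < e / 4 by rewrite divr_gt0.
have [N HN] := rU x Kx _ e40; have [M HM] := rW x Kx _ e40.
have /within_continuous_eballP/(_ x Kx _ e40)[d d0 Hd] := UC.
exists (Num.min d (mesh (maxn N M))); first by rewrite lt_min d0 mesh_gt0.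
exists (maxn N M) => k y; rewrite geq_max => /andP[Nk Mk] Ky.
rewrite lt_min => /andP[/(Hd y Ky) + yx].
have yN := lt_le_trans yx (mesh_le (leq_maxl N M)).
have yM := lt_le_trans yx (mesh_le (leq_maxr N M)).
have := HN k y Nk Ky yN; have := HM k y Mk Ky yM.
rewrite /h /= !ltr_norml -[W x]opprK -UW//.
move: (g k y) (U x) (U y) => a b b' ? ? /andP[? ?].
by apply/andP; split; lra.
Qed.

End Operator.

(** * Exterior cones contain exterior balls *)

Section Cone.
Context {R : realType} {n : nat}.
Implicit Types (Omega : set 'rV[R]_n.+1).

Lemma dotE (x y : 'rV[R]_n.+1) : dot x y = (x *m y^T) 0 0.
Proof. by rewrite mxE; apply: eq_bigr => i _; rewrite mxE. Qed.

Lemma enorm_orthogonal (Q : 'M[R]_n.+1) x : Q *m Q^T = 1%:M -> enorm (x *m Q) = enorm x.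
Proof.
move=> QQ; apply/eqP; rewrite -(@eqrXn2 _ 2) ?enorm_ge0//.
by rewrite !sqr_enorm !dotE trmx_mul mulmxA -(mulmxA x) QQ mulmx1.
Qed.

(** The ball of radius [(1 - cos alpha) / 2 * s] about the point of the axis at
    distance [s] from the apex lies in the cone; with [c = cos alpha] and [k = (1 - c) / 2]
    the condition is [(1 + k) * c <= 1 - k], i.e. [0 <= (1 - c)^2]. *)
Lemma cone_exterior_balls Omega : uniform_exterior_cone Omega -> exterior_balls Omega.
Proof.
move=> [alpha [r [/andP[a0 a1] r0 Hcone]]].
have c0 : 0 < cos alpha.
  by apply: cos_gt0_pihalf; rewrite a1 (lt_trans _ a0)// oppr_lt0 divr_gt0// pi_gt0.
have c1 : cos alpha < 1.
  have s0 : 0 < sin alpha.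
    by apply: sin_gt0_pi; rewrite a0 (lt_trans a1)//; have := pi_gt0 R; lra.
  have := cos2Dsin2 alpha; have := exprn_gt0 2 s0; nra.
set c := cos alpha in c0 c1 *.
exists ((1 - c) / 2), (r / 2); split; [lra|lra|].
move=> xi s bxi /andP[s0 sr].
have [Q [[QQ _] HQ]] := Hcone xi bxi.
have QQ' : Q^T *m Q = 1%:M by exact: mulmx1C.
pose v0 : 'rV[R]_n.+1 := (- s) *: basis_vec0.
have nv0 : enorm v0 = s by rewrite enormZ enorm_basis_vec0 mulr1 normrN ger0_norm// ltW.
exists (xi + v0 *m Q); first by rewrite (addrC xi) addrK enorm_orthogonal.
move=> x Kx; rewrite leNgt; apply/negP => xz.
have e0 : 0 < (1 - c) / 2 * s - enorm (x - (xi + v0 *m Q)) by rewrite subr_gt0.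
have [y Oy yx] := (closure_eballP _ _).1 Kx _ e0.
set z := xi + v0 *m Q in xz e0 yx.
have yz : enorm (y - z) < (1 - c) / 2 * s by have := enorm_tri y x z; lra.
pose w := (y - z) *m Q^T.
have nw : enorm w = enorm (y - z) by apply: enorm_orthogonal; rewrite trmxK.
have := HQ y; apply => //; exists (v0 + w); last first.
  by rewrite mulmxDl /w -mulmxA QQ' mulmx1 addrA -/z addrC subrK.
have nvw : enorm (v0 + w) <= s + (1 - c) / 2 * s.
  by rewrite (le_trans (enormD _ _))// nv0 nw lerD2l ltW.
have sc : 0 < s * (1 - c) by rewrite mulr_gt0// subr_gt0.
split; last by nra.
have w0 : w 0 ord0 <= (1 - c) / 2 * s.
  by rewrite (le_trans (ler_norm _))// (le_trans (coord_le_enorm _ _))// nw ltW.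
have -> : (v0 + w) 0 ord0 = - s + w 0 ord0.
  by rewrite mxE /v0 mxE mxE eqxx mulr1.
have : enorm (v0 + w) * c <= (s + (1 - c) / 2 * s) * c by rewrite ler_wpM2r// ltW.
have : 0 <= s * (1 - c) ^+ 2 by rewrite mulr_ge0 ?sqr_ge0 ?ltW.
rewrite mulNr -/c; lra.
Qed.

End Cone.
(** * The Dirichlet problem *)

Theorem corollary1p1 (R : realType) (n : nat) (Omega : set 'rV[R]_n.+1)
    (p lambda Lambda : R) (rho : 'rV[R]_n.+1 -> R)
    (domO : is_domain Omega) (bndO : bounded_set Omega)
    (coneO : uniform_exterior_cone Omega)
    (p2 : 2 <= p)
    (rhoC : {within closure Omega, continuous rho})
    (rho_adm : admissible_radius Omega rho)
    (rho_dist : forall x, Omega x ->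
      lambda * dist_set x (boundary Omega) <= rho x
        <= Lambda * dist_set x (boundary Omega))
    (lambda0 : 0 < lambda) (lambdaLambda : lambda <= Lambda)
    (Lambda_lt : Lambda < (n.+1%:R + 2) / (n.+1%:R + p))
    (f : 'rV[R]_n.+1 -> R) (fC : {within boundary Omega, continuous f}) :
  exists u_rho : 'rV[R]_n.+1 -> R,
    [/\ dirichlet_solution Omega rho p f u_rho,
        (forall v : 'rV[R]_n.+1 -> R, dirichlet_solution Omega rho p f v ->
           forall x, closure Omega x -> v x = u_rho x) &
        (forall u : 'rV[R]_n.+1 -> R, norm_preserving_extension Omega f u ->
           {uniform closure Omega,
             (fun k : nat => iter k (pmean_op Omega rho p) u) @ \oo --> u_rho})].
Proof.
have [_ oO _] := domO.
have ext := cone_exterior_balls coneO.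
have conv u := @iterates_converge R n Omega rho p oO bndO p2 rhoC rho_adm f u ext.
have uniq := @solution_unique R n Omega rho p oO bndO p2 rho_adm f.
have cK := compact_closure_domain bndO.
have clb : closed (boundary Omega).
  by apply: closedI; [exact: closed_closure|apply: open_closedC; exact: open_interior].
have cb : compact (boundary Omega).
  by apply: subclosed_compact cK _ => //; exact: boundary_closure.
have [C0 [_ HC0]] := compact_bounded (continuous_compact fC cb).
pose C := `|C0| + 1.
have C0C : C0 < C by rewrite ltr_pwDr// ler_norm.
have fb x : boundary Omega x -> `|f x| <= C by move=> bx; apply: HC0 => //; exists x.
have C_gt0 : 0 < C by rewrite ltr_wpDl.
have [u0 [u0f u0C _]] :=
  continuous_bounded_extension (@pseudometric_normal R _) clb C_gt0 fC fb.
have [] := conv u0.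
- exact: continuous_subspaceT.
- by move=> x bx; rewrite u0f// inE.
move=> v vsol _; exists v; split => //.
  move=> w wsol x Kx; apply/eqP; rewrite eq_le.
  by rewrite (uniq w v wsol vsol x Kx) (uniq v w vsol wsol x Kx).
move=> u [uC uf _]; have [w wsol wconv] := conv u uC uf.
move=> P /uniform_nbhs[E [/= entE EP]].
have [e e0 Ee] : exists2 e : R, 0 < e & forall a b : R, `|a - b| < e -> E (a, b).
  move: entE; rewrite -entourage_ballE => -[e e0 He]; exists e => // a b ab.
  exact: He.
(* the limit does not depend on the extension, by uniqueness *)
have [N HN] := wconv e e0; exists N => // k /= Nk; apply: EP => x Kx /=.
apply: Ee; rewrite distrC.
have -> : v x = w x.
  apply/eqP; rewrite eq_le.
  by rewrite (uniq w v wsol vsol x Kx) (uniq v w vsol wsol x Kx).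
exact: HN.
Qed.
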